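(* For every non-zero $f\in K[x]_{\mu\text{-att}}$, one has $u_r(f)\in\Gamma_{r-1}$ and $$H_\mu(f)=x_r^{\,s_r(f)}\,p_r^{\,u_r(f)}\,R_r(f)(y_r)\quad\text{in }\mathcal G_\mu.$$
   Context: Let $(K,v)$ be a valued field with non-trivial value group $\Gamma$, residue field $k$, $\Gamma_{\mathbb Q}=\Gamma\otimes\mathbb Q$. For a valuation $\mu$ on $K[x]$: $\mathcal P_\alpha=\{g:\mu(g)\ge\alpha\}\supseteq\mathcal P^+_\alpha=\{g:\mu(g)>\alpha\}$, graded algebra $\mathcal G_\mu=\bigoplus_\alpha\mathcal P_\alpha/\mathcal P_\alpha^+$, $\Delta_\mu=\mathcal P_0/\mathcal P_0^+$, initial form $H_\mu(g)=g+\mathcal P^+_{\mu(g)}$ (multiplicative; extended multiplicatively to quotients); $h\mid_\mu g$ iff $H_\mu(h)\mid H_\mu(g)$. Key polynomial: monic $\phi$ with $H_\mu(\phi)\mathcal G_\mu$ non-zero prime and $\phi\nmid_\mu f$ for non-zero $f$ of smaller degree; $[\mu;\phi,\gamma](\sum a_s\phi^s)=\min(\mu(a_s)+s\gamma)$ for $\gamma>\mu(\phi)$. For $\mu\le\mu'$ in a chain, the canonical map $\mathcal G_\mu\to\mathcal G_{\mu'}$ sends $H_\mu(f)$ to $H_{\mu'}(f)$ if $\mu(f)=\mu'(f)$, else to $0$. MacLane chain $\mu_{-\infty}\xrightarrow{\phi_0,\gamma_0}\mu_0\to\cdots\xrightarrow{\phi_r,\gamma_r}\mu_r=\mu$: $\gamma_i\in\Gamma_{\mathbb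 Q}$, $\phi_0=x+a$, $\mu_0(\sum a_s\phi_0^s)=\min(v(a_s)+s\gamma_0)$, $\phi_i$ key polynomial for $\mu_{i-1}$, $\mu_i=[\mu_{i-1};\phi_i,\gamma_i]$, $\phi_{i+1}\nmid_{\mu_i}\phi_i$. $\mu_{-1}=v$, $\Gamma_{\mu_{-1}}=\Gamma$, $m_i=\deg\phi_i$, $e_i=(\Gamma_{\mu_i}:\Gamma_{\mu_{i-1}})$, $h_i=e_i\gamma_i\in\Gamma_{\mu_{i-1}}$. $\Delta_i=\Delta_{\mu_i}$; $\kappa_0$ = image of $k$ in $\Delta_0$, $\kappa_i$ = image of $\Delta_{i-1}\to\Delta_i$; one identifies $k=\kappa_0\subset\cdots\subset\kappa_r$, and $\Delta_i^*=\kappa_i^*$. Fix a finitely generated $\Gamma_{-1}\subseteq\Gamma$ with $h_i\in\Gamma_{-1}+\langle\gamma_0,\dots,\gamma_{i-1}\rangle$; $\Gamma_i=\langle\Gamma_{-1},\gamma_0,\dots,\gamma_i\rangle$ (free of rank $n$; $\Gamma_i\cap\Gamma_{\mu_{i-1}}=\Gamma_{i-1}$; $h_i\in\Gamma_{i-1}$). Bases: $\iota_{0,\cdot}$ of $\Gamma_{-1}$ fixed; recursively $\gamma_i=\sum_j(h_{i,j}/e_{i,j})\iota_{i,j}$ (coprime, $e_{i,j}>0$), $e'_{i,1}=d_{i,1}=1$, $e'_{i,j}=\prod_{t<j}e_{i,t}/\prod_{t<j}d_{i,t}$, $d_{i,j}=\gcd(e_{i,j},e'_{i,j})$, integers $\ell_{i,j}h_{i,j}e'_{i,j}+\ell'_{i,j}e_{i,j}=d_{i,j}$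 with $0\le\ell_{i,j}<e_{i,j}/d_{i,j}$, and $(\iota_{i+1,\cdot})=(\iota_{i,\cdot})Q_i$, $Q_i$ lower triangular, diagonal $d_{i,j}/e_{i,j}$, $(m,j)$-entry $\ell_{i,j}e'_{i,j}h_{i,m}/e_{i,m}$ ($m>j$); a basis of $\Gamma_i$. Rational functions: $\pi_{0,j}\in K^*$ with $v(\pi_{0,j})=\iota_{0,j}$; $\pi_{i+1,j}=(\phi_i\pi_{i,1}^{-h_{i,1}/e_{i,1}}\cdots\pi_{i,j-1}^{-h_{i,j-1}/e_{i,j-1}})^{\ell_{i,j}e'_{i,j}}\pi_{i,j}^{\ell'_{i,j}}$; $\pi_i^\alpha=\prod_j\pi_{i,j}^{n_j}$ for $\alpha=\sum n_j\iota_{i,j}\in\Gamma_{i-1}$; $Y_i=\phi_i^{e_i}\pi_i^{-h_i}$. Graded elements: $x_r=H_\mu(\phi_r)$, $y_r=H_\mu(Y_r)\in\Delta_\mu$, $p_r^\alpha=H_\mu(\pi_r^\alpha)\in\mathcal G_\mu^*$ for $\alpha\in\Gamma_{r-1}$. ($y_r$ is transcendental over $\kappa_r$ and $\Delta_\mu=\kappa_r[y_r]$.) Residual polynomial: for non-zero $f=\sum_sa_s\phi_r^s$ ($\deg a_s<m_r$), $N_r(f)$ is the lower convex hull in $\mathbb Q\times\Gamma_{\mathbb Q}$ of $Q_s=(s,\mu_{r-1}(a_s))$, $a_s\ne0$; $S_{\gamma_r}(f)$ is the set of $(s,u)\in N_r(f)$ minimizing $u+s\gamma_r$, with left endpoint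 $(s_r(f),u_r(f))$ and right endpoint $(s'_r(f),u'_r(f))$; $d=(s'_r(f)-s_r(f))/e_r\in\mathbb Z$, $s_j=s_r(f)+je_r$. $K[x]_{\mu\text{-att}}=\{0\}\cup\{g\ne0:\mu(g)\in\Gamma_r\}$. For non-zero $f\in K[x]_{\mu\text{-att}}$, $R_r(f)=\sum_{j=0}^dc_jy^j\in\kappa_r[y]$ with $c_j=p_r^{-\mu_{r-1}(a_{s_j})}H_\mu(a_{s_j})\in\kappa_r^*$ if $Q_{s_j}$ lies on $N_r(f)$ and $c_j=0$ otherwise; $R_r(0)=0$. *)

(* Defs.v *)
From HB Require Import structures.
From mathcomp Require Import all_boot all_order all_algebra.
From Stdlib Require Import ClassicalEpsilon.
Set Implicit Arguments. Unset Strict Implicit. Unset Printing Implicit Defensive.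
Import GRing.Theory.
Local Open Scope ring_scope.

(* Data of a MacLane chain over a valued field (K,v) whose values lie in the
   Q-vector space G = Gamma_Q (ordered by [le]).  Indices j of bases run over
   0 <= j < rk (the paper's 1 <= j <= n). *)
Record chain (K : fieldType) (G : lmodType rat) := Chain {
  le : rel G;
  val : K -> G;               (* v on K^* *)
  phi : nat -> {poly K};
  gam : nat -> G;
  eidx : nat -> nat;          (* e_i = (Gamma_{mu_i} : Gamma_{mu_{i-1}}) *)
  rk : nat;
  iota0 : nat -> G;           (* iota_{0,j} : basis of Gamma_{-1} *)
  pi0 : nat -> K;
  hh : nat -> nat -> int;
  ee : nat -> nat -> nat;
  ll : nat -> nat -> int;
  ll' : nat -> nat -> int
}.

Section Defs.
Variables (K : fieldType) (G : lmodType rat) (C : chain K G).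

Definition glt (a b : G) := le C a b && (a != b).
Definition gmin (a b : G) := if le C a b then a else b.
Definition gminl (s : seq G) : G := if s is a :: s' then foldr gmin a s' else 0.

(* phi-adic expansion f = sum_s a_s phi^s, deg a_s < deg phi (phi monic) *)
Fixpoint phiexp_rec (k : nat) (p f : {poly K}) : seq {poly K} :=
  if k is k'.+1 then (f %% p) :: phiexp_rec k' p (f %/ p) else [::].
Definition phiexp (p f : {poly K}) := phiexp_rec (size f) p f.
Definition coefs (p f : {poly K}) (s : nat) := nth 0 (phiexp p f) s.

(* augmented valuation [mu; p, g](sum a_s p^s) = min (mu(a_s) + s g)
   (only used on non-zero polynomials) *)
Definition augment (mu : {poly K} -> G) (p : {poly K}) (g : G) (f : {poly K}) : G :=
  gminl [seq mu (coefs p f s) + g *+ s | s <- iota 0 (size (phiexp p f)) & coefs p f s != 0].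

(* muc 0 = mu_{-1} = v (on constants); muc i.+1 = mu_i = [mu_{i-1}; phi_i, gamma_i];
   in particular mu_0 (sum a_s phi_0^s) = min (v(a_s) + s gamma_0). *)
Fixpoint muc (k : nat) : {poly K} -> G :=
  if k is k'.+1 then augment (muc k') (phi C k') (gam C k') else fun f => val C (f`_0).

(* An element of G_mu = (+)_alpha P_alpha/P_alpha^+ is represented by a finite
   formal sum of pairs (alpha, g) with g in P_alpha, standing for the sum of
   the classes g + P_alpha^+ ; [greq] is equality in G_mu. *)
Definition gr := seq (G * {poly K}).
Definition gzero : gr := [::].
Definition gone : gr := [:: (0, 1)].
Definition gadd (a b : gr) : gr := a ++ b.
Definition gmul (a b : gr) : gr := [seq (x.1 + y.1, x.2 * y.2) | x <- a, y <- b].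
Fixpoint gexp (a : gr) (n : nat) : gr := if n is n'.+1 then gmul a (gexp a n') else gone.
Definition gsum (l : seq gr) : gr := flatten l.

Section Mu.
Variable mu : {poly K} -> G.
Definition valid (a : gr) := all (fun x => (x.2 == 0) || le C x.1 (mu x.2)) a.
Definition comp (a : gr) (b : G) : {poly K} := \sum_(x <- a | x.1 == b) x.2.
Definition greq (a b : gr) : Prop :=
  forall g : G, comp a g - comp b g = 0 \/ glt g (mu (comp a g - comp b g)).
Definition Hmu (f : {poly K}) : gr := if f == 0 then gzero else [:: (mu f, f)].
Definition gdvd (a b : gr) := exists c, valid c /\ greq (gmul a c) b.
Definition gunit (a : gr) := gdvd a gone.
Definition nz_prime_elt (a : gr) :=
  ~ greq a gzero /\ ~ gunit a /\
  forall b c, valid b -> valid c -> gdvd a (gmul b c) -> gdvd a b \/ gdvd a c.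
Definition mu_div (h g : {poly K}) := gdvd (Hmu h) (Hmu g).
Definition key_poly (p : {poly K}) :=
  p \is monic /\ nz_prime_elt (Hmu p) /\
  forall f : {poly K}, f != 0 -> (size f < size p)%N -> ~ mu_div p f.
(* H_mu extended multiplicatively to quotients: H(g/h) = H(g) H(h)^{-1} *)
Definition Hfrac (q : {fraction {poly K}}) : gr :=
  epsilon (inhabits gzero) (fun z => valid z /\ exists g h : {poly K},
    h != 0 /\ q = FracField.tofrac g / FracField.tofrac h /\ greq (gmul z (Hmu h)) (Hmu g)).
End Mu.

Definition Gam (g : G) := exists a : K, a != 0 /\ val C a = g.
(* GamMu k = Gamma_{mu_{k-1}} *)
Definition GamMu (k : nat) (g : G) : Prop :=
  if k is k'.+1 then exists a b : {poly K}, a != 0 /\ b != 0 /\ g = muc k a - muc k b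
  else Gam g.
Definition index_is (A B : G -> Prop) (e : nat) :=
  exists b : nat -> G, (forall k, (k < e)%N -> B (b k)) /\
    (forall k l, (k < e)%N -> (l < e)%N -> A (b k - b l) -> k = l) /\
    (forall x, B x -> exists2 k, (k < e)%N & A (x - b k)).
(* GamIdx k = Gamma_{k-1} = < Gamma_{-1}, gamma_0, ..., gamma_{k-1} > *)
Definition GamIdx (k : nat) (g : G) : Prop :=
  exists c z : nat -> int,
    g = \sum_(j < rk C) iota0 C j *~ c j + \sum_(t < k) gam C t *~ z t.
Definition hbig (i : nat) : G := gam C i *+ eidx C i.

Fixpoint eprime (i j : nat) : nat :=
  if j is j'.+1 then eprime i j' * (ee C i j' %/ gcdn (ee C i j') (eprime i j'))
  else 1.
Definition dd (i j : nat) : nat := gcdn (ee C i j) (eprime i j).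
Definition Qcoef (i m j : nat) : rat :=
  if m == j then (dd i j)%:R / (ee C i j)%:R
  else if (j < m)%N then (ll C i j)%:~R * (eprime i j)%:R * (hh C i m)%:~R / (ee C i m)%:R
  else 0.
Fixpoint iotab (i j : nat) : G :=
  if i is i'.+1 then \sum_(m < rk C) Qcoef i' m j *: iotab i' m else iota0 C j.

Local Notation F := {fraction {poly K}}.
Local Notation tof := (@FracField.tofrac _).
(* pi_{i+1,j} = (phi_i pi_{i,1}^{-h_{i,1}/e_{i,1}} ... )^{l e'} pi_{i,j}^{l'};
   the exponent of pi_{i,t} is -(l_{i,j} (e'_{i,j}/e_{i,t}) h_{i,t}), e_{i,t} | e'_{i,j} *)
Fixpoint piF (i : nat) : nat -> F := fun j =>
  if i is i'.+1 then
    (tof (phi C i')) ^ (ll C i' j * (eprime i' j)%:Z) *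
    \prod_(t < j) (piF i' t) ^ (- (ll C i' j * ((eprime i' j) %/ (ee C i' t))%:Z * hh C i' t)) *
    (piF i' j) ^ (ll' C i' j)
  else tof ((pi0 C j)%:P).
Definition coords (i : nat) (a : G) : nat -> int :=
  epsilon (inhabits (fun _ : nat => (0 : int))) (fun c : nat -> int => a = \sum_(j < rk C) iotab i j *~ c j).
Definition pipow (i : nat) (a : G) : F := \prod_(j < rk C) piF i j ^ (coords i a j).
Definition Yr (i : nat) : F := (tof (phi C i)) ^+ eidx C i * pipow i (- hbig i).

(* ---------- graded elements at level r (mu = mu_r = muc r.+1) ----------- *)
Definition xr (r : nat) : gr := Hmu (muc r.+1) (phi C r).
Definition yr (r : nat) : gr := Hfrac (muc r.+1) (Yr r).
Definition pr (r : nat) (a : G) : gr := Hfrac (muc r.+1) (pipow r a).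

Definition npts (r : nat) (f : {poly K}) : seq (nat * G) :=
  [seq (s, muc r (coefs (phi C r) f s)) | s <- iota 0 (size (phiexp (phi C r) f))
     & coefs (phi C r) f s != 0].
Definition conv_pt (pts : seq (nat * G)) (t : rat) (w : G) : Prop :=
  exists lam : nat -> rat, (forall k, 0 <= lam k) /\
    \sum_(k < size pts) lam k = 1 /\
    t = \sum_(k < size pts) lam k * ((nth (0%N, 0) pts k).1)%:R /\
    w = \sum_(k < size pts) lam k *: (nth (0%N, 0) pts k).2.
(* (t,w) lies on N_r(f), the lower convex hull of the Q_s *)
Definition onN (r : nat) (f : {poly K}) (t : rat) (w : G) : Prop :=
  conv_pt (npts r f) t w /\ forall w', conv_pt (npts r f) t w' -> le C w w'.
Definition inS (r : nat) (f : {poly K}) (t : rat) (w : G) : Prop :=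
  onN r f t w /\ forall t' w', onN r f t' w' -> le C (w + t *: gam C r) (w' + t' *: gam C r).
Definition sL (r : nat) (f : {poly K}) : nat :=
  epsilon (inhabits 0%N) (fun s : nat =>
    (exists u, inS r f s%:R u) /\ forall t w, inS r f t w -> s%:R <= t).
Definition uL (r : nat) (f : {poly K}) : G :=
  epsilon (inhabits 0) (fun u => inS r f (sL r f)%:R u).
Definition sR (r : nat) (f : {poly K}) : nat :=
  epsilon (inhabits 0%N) (fun s : nat =>
    (exists u, inS r f s%:R u) /\ forall t w, inS r f t w -> t <= s%:R).

Definition Rcoef (r : nat) (f : {poly K}) (j : nat) : gr :=
  let s := (sL r f + j * eidx C r)%N in
  let a := coefs (phi C r) f s in
  if excluded_middle_informative (a != 0 /\ onN r f s%:R (muc r a)) then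
    gmul (pr r (- muc r a)) (Hmu (muc r.+1) a)
  else gzero.
Definition Rres (r : nat) (f : {poly K}) : seq gr :=
  [seq Rcoef r f j | j <- iota 0 ((sR r f - sL r f) %/ eidx C r).+1].
Definition Reval (c : seq gr) (y : gr) : gr :=
  gsum [seq gmul (nth gzero c j) (gexp y j) | j <- iota 0 (size c)].

Definition MacLane_setup (r : nat) : Prop :=
  [/\
      [/\ forall a, le C a a,
          forall a b c, le C a b -> le C b c -> le C a c,
          forall a b, le C a b -> le C b a -> a = b,
          forall a b, le C a b || le C b a &
          forall a b c, le C a b -> le C (a + c) (b + c)],
      (* v is a non-trivial valuation on K with values Gamma, Gamma_Q = Gamma (x) Q *)
      [/\ forall a b, a != 0 -> b != 0 -> val C (a * b) = val C a + val C b,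
          forall a b, a != 0 -> b != 0 -> a + b != 0 ->
                      le C (gmin (val C a) (val C b)) (val C (a + b)),
          exists a, a != 0 /\ val C a != 0 &
          forall g, exists2 n, (0 < n)%N & Gam (g *+ n)],
      [/\ exists a, phi C 0 = 'X + a%:P,
          forall i, (0 < i <= r)%N ->
             key_poly (muc i) (phi C i) /\ glt (muc i (phi C i)) (gam C i),
          forall i, (i < r)%N -> ~ mu_div (muc i.+1) (phi C i.+1) (phi C i) &
          forall i, (i <= r)%N ->
             (0 < eidx C i)%N /\ index_is (GamMu i) (GamMu i.+1) (eidx C i)],
      [/\ forall j, (j < rk C)%N -> Gam (iota0 C j),
          forall c : nat -> int, \sum_(j < rk C) iota0 C j *~ c j = 0 ->
             forall j, (j < rk C)%N -> c j = 0 &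
          forall i, (i <= r)%N -> GamIdx i (hbig i)] &
      [/\ forall i, (i < r)%N ->
             gam C i = \sum_(m < rk C) ((hh C i m)%:~R / (ee C i m)%:R) *: iotab i m,
          forall i j, (i < r)%N -> (j < rk C)%N ->
             (0 < ee C i j)%N /\ coprime `|hh C i j|%N (ee C i j),
          forall i j, (i < r)%N -> (j < rk C)%N ->
             [/\ ll C i j * hh C i j * (eprime i j)%:Z + ll' C i j * (ee C i j)%:Z
                   = (dd i j)%:Z,
                 0 <= ll C i j & ll C i j < ((ee C i j) %/ (dd i j))%:Z] &
          forall j, (j < rk C)%N -> pi0 C j != 0 /\ val C (pi0 C j) = iota0 C j]].

End Defs.

(* Main.v *)
Require Import Defs.
From HB Require Import structures.
From mathcomp Require Import all_boot all_order all_algebra.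
From mathcomp Require Import ring.
From Stdlib Require Import ClassicalEpsilon.
Set Implicit Arguments. Unset Strict Implicit. Unset Printing Implicit Defensive.
Import Order.TTheory GRing.Theory Num.Theory.
Local Open Scope ring_scope.

(** The augmentation of a valuation by a key polynomial [phi] is a valuation
    because primality of the initial form of [phi] controls products of
    polynomials of degree less than [deg phi]; moreover the initial form of a
    polynomial that [phi] does not mu-divide becomes a unit, its inverse coming
    from a Bezout relation with [phi].  Hence the [phi_i] with [i < r], and
    with them all the [pi_r^alpha], are units of the graded algebra of [mu_r].

    The terms of least value in the [phi_r]-expansion of [f] are those on the
    side of slope [- gamma_r] of the Newton polygon.  Since the order of
    [gamma_r] modulo the value group of [mu_{r-1}] is [e_r], their abscissas are
    congruent to [s_r(f)] modulo [e_r], and each of them is rewritten through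
    [pi_r^u pi_r^{- (u - j h_r)} pi_r^{- j h_r} = 1].  *)

(** * Ordered groups *)

Definition group_order (G : zmodType) (R : rel G) :=
  [/\ forall a, R a a,
      forall a b c, R a b -> R b c -> R a c,
      forall a b, R a b -> R b a -> a = b,
      forall a b, R a b || R b a &
      forall a b c, R a b -> R (a + c) (b + c)].

(* A copy of G ordered by R; its strict order is the one of [glt] in order
   that [<=] and [<] be convertible to [le C] and [glt C] when R is [le C]. *)
Definition value_group (G : zmodType) (R : rel G) (oR : group_order R) : Type := G.

Section ValueGroupOrder.
Variables (G : zmodType) (R : rel G) (oR : group_order R).
Local Notation V := (value_group oR).
Implicit Types x y : V.

HB.instance Definition _ := GRing.Zmodule.on V.

Definition value_group_lt : rel V := fun x y => R x y && (x != y).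

Fact value_group_lt_def x y : value_group_lt x y = (y != x) && R x y.
Proof. by rewrite /value_group_lt andbC eq_sym. Qed.

Fact value_group_le_refl : reflexive (R : rel V). Proof. by have [] := oR. Qed.

Fact value_group_le_anti : antisymmetric (R : rel V).
Proof. by have [_ _ anti _ _] := oR; move=> x y /andP[]; apply: anti. Qed.

Fact value_group_le_trans : transitive (R : rel V).
Proof. by have [_ trans _ _ _] := oR; move=> y x z; apply: trans. Qed.

HB.instance Definition _ := Order.isPOrder.Build ring_display V
  value_group_lt_def value_group_le_refl value_group_le_anti value_group_le_trans.

Fact value_group_le_total : total (R : rel V). Proof. by have [] := oR. Qed.

HB.instance Definition _ := Order.POrder_isTotal.Build ring_display V value_group_le_total.

End ValueGroupOrder.

Section ValueGroup.
Variables (G : zmodType) (R : rel G) (oR : group_order R).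
Local Notation V := (value_group oR).
Implicit Types (x y z t : V) (b : bool) (n : nat).

Lemma legD2r z x y : (x + z <= y + z) = (x <= y).
Proof.
have leD2r (a b c : V) : a <= b -> a + c <= b + c by have [_ _ _ _] := oR; apply.
by apply/idP/idP => [/(leD2r _ _ (- z))|]; [rewrite !addrK | apply: leD2r].
Qed.

Lemma ltgD2r z x y : (x + z < y + z) = (x < y).
Proof. by rewrite !ltNge legD2r. Qed.

Lemma legD2l z x y : (z + x <= z + y) = (x <= y).
Proof. by rewrite ![z + _]addrC legD2r. Qed.

Lemma ltgD2l z x y : (z + x < z + y) = (x < y).
Proof. by rewrite ![z + _]addrC ltgD2r. Qed.

Lemma lteifgD2r b z x y : (x + z < y + z ?<= if b) = (x < y ?<= if b).
Proof. by case: b; rewrite /= ?legD2r ?ltgD2r. Qed.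

Lemma lteifgD2l b z x y : (z + x < z + y ?<= if b) = (x < y ?<= if b).
Proof. by rewrite ![z + _]addrC lteifgD2r. Qed.

Lemma lteifg_leD b x y z t : x < y ?<= if b -> z <= t -> x + z < y + t ?<= if b.
Proof.
rewrite -(lteifgD2r b z) -(legD2l y); case: b => /=; first exact: le_trans.
exact: lt_le_trans.
Qed.

Lemma legD x y z t : x <= y -> z <= t -> x + z <= y + t.
Proof. exact: (@lteifg_leD true). Qed.

Lemma lteifgBlDr b x y z : (x - y < z ?<= if b) = (x < z + y ?<= if b).
Proof. by rewrite -(lteifgD2r b y (x - y)) subrK. Qed.

Lemma legBlDr x y z : (x - y <= z) = (x <= z + y).
Proof. exact: (lteifgBlDr true). Qed.

Lemma legBrDr x y z : (x <= y - z) = (x + z <= y).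
Proof. by rewrite -(legD2r z x) subrK. Qed.

Lemma subg_ge0 x y : (0 <= x - y) = (y <= x).
Proof. by rewrite legBrDr add0r. Qed.

Lemma legN2 x y : (- x <= - y) = (y <= x).
Proof. by rewrite -(subg_ge0 _ (- x)) opprK addrC subg_ge0. Qed.

Lemma ltgN2 x y : (- x < - y) = (y < x).
Proof. by rewrite !ltNge legN2. Qed.

Lemma mulrng_ge0 n x : 0 <= x -> 0 <= x *+ n.
Proof.
by move=> x0; elim: n => [|n IH]; rewrite ?mulr0n // mulrS -[0]addr0 legD.
Qed.

Lemma mulrng_lt0 n x : x < 0 -> x *+ n.+1 < 0.
Proof.
move=> x0; elim: n => [|n IH] //; rewrite mulrS -[X in _ < X]addr0.
exact: (@lteifg_leD false) x0 (ltW IH).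
Qed.

Lemma sumg_ge0 (I : Type) (s : seq I) (P : pred I) (F : I -> V) :
  (forall i, P i -> 0 <= F i) -> 0 <= \sum_(i <- s | P i) F i.
Proof.
move=> F0; elim/big_ind: _ => [|x y x0 y0|i /F0] //.
by rewrite -[0]addr0 legD.
Qed.

Lemma sumg_eq0 (I : finType) (F : I -> V) :
  (forall i, 0 <= F i) -> \sum_i F i = 0 -> forall i, F i = 0.
Proof.
move=> F0 sum0 i; apply: le_anti; rewrite F0 andbT -sum0 (bigD1 i) //=.
by rewrite -{1}[F i]addr0 legD2l sumg_ge0.
Qed.

End ValueGroup.

Lemma scaleg_ge0 (G : lmodType rat) (R : rel G) (oR : group_order R) (q : rat) (x : G) :
  0 <= q -> 0 <= x :> value_group oR -> 0 <= q *: x :> value_group oR.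
Proof.
move=> q0 x0; rewrite leNgt; apply/negP => qx0.
have [d dE] : {d | denq q = d.+1%:Z}.
  by have := denq_gt0 q; case: (denq q) => -[|d] //; exists d.
have := mulrng_lt0 d qx0; rewrite -scaler_nat scalerA -[q]divq_num_den dE mulrC -pmulrn.
rewrite divfK ?pnatr_eq0 // -[numq q]gez0_abs ?numq_ge0 // scaler_nat.
by move/(le_lt_trans (mulrng_ge0 _ x0)); rewrite ltxx.
Qed.

Section OrderOfChain.
Variables (K : fieldType) (G : lmodType rat) (C : chain K G) (oC : group_order (le C)).
Local Notation V := (value_group oC).
Implicit Types x y : V.

Lemma gmin_min x y : gmin C x y = Order.min x y.
Proof. by rewrite minEle. Qed.

Lemma gminl_in (s : seq V) : s != [::] -> gminl C s \in s.
Proof.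
case: s => // x s _ /=; elim: s => [|y s IH] /=; first by rewrite inE.
rewrite gmin_min; case: (leP y (foldr (gmin C) x s)) => _; first by rewrite !inE eqxx orbT.
by move: IH; rewrite !inE => /orP[->|->]; rewrite ?orbT.
Qed.

Lemma gminl_le (s : seq V) x : x \in s -> (gminl C s : V) <= x.
Proof.
case: s => // y s /=; elim: s x => [|z s IH] x /=; first by rewrite inE => /eqP ->.
rewrite gmin_min ge_min !inE => /or3P[/eqP->|/eqP->|xs]; first 1 last.
- by rewrite lexx.
- by rewrite IH ?orbT // !inE xs orbT.
- by rewrite IH ?orbT // !inE eqxx.
Qed.

End OrderOfChain.

(** * Filtrations and valuations *)

(* P_al if [b] is true and P_al^+ if [b] is false; the value of [mu] at 0 is
   irrelevant. *)
Definition filt (A : zmodType) (G : zmodType) (R : rel G) (oR : group_order R)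
    (b : bool) (mu : A -> value_group oR) (al : value_group oR) (f : A) :=
  (f == 0) || (al < mu f ?<= if b).

Notation Pge := (filt true).
Notation Pgt := (filt false).

Section Filtration.
Variables (A : zmodType) (G : zmodType) (R : rel G) (oR : group_order R).
Local Notation V := (value_group oR).
Implicit Types (mu nu : A -> V) (al be : V) (b : bool) (f g h : A).

Lemma filt0 b mu al : filt b mu al 0. Proof. by rewrite /filt eqxx. Qed.

Lemma filt_neq0 b mu al f : f != 0 -> filt b mu al f = (al < mu f ?<= if b).
Proof. by rewrite /filt => /negbTE ->. Qed.

Lemma Pge_value mu f : Pge mu (mu f) f.
Proof. by rewrite /filt /= lexx orbT. Qed.

Lemma PgtF mu f : f != 0 -> Pgt mu (mu f) f = false.
Proof. by move=> f0; rewrite filt_neq0 //= ltxx. Qed.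

Lemma filt_Pge b mu al f : filt b mu al f -> Pge mu al f.
Proof. by case: b => //; rewrite /filt /= => /orP[->//|/ltW ->]; rewrite orbT. Qed.

Lemma filt_le b mu al be f : al <= be -> filt b mu be f -> filt b mu al f.
Proof.
move=> al_be; rewrite /filt; case: (f == 0) => //=.
by case: b => /=; [apply: le_trans | apply: le_lt_trans].
Qed.

Lemma Pge_lt mu al be f : al < be -> Pge mu be f -> Pgt mu al f.
Proof. by move=> al_be; rewrite /filt; case: (f == 0) => //=; apply: lt_le_trans. Qed.

Lemma value_eq mu al f : f != 0 -> Pge mu al f -> ~~ Pgt mu al f -> mu f = al.
Proof.
move=> f0; rewrite !filt_neq0 //= -leNgt => al_le le_al.
by apply: le_anti; rewrite le_al.
Qed.

Lemma value_eq_Pge mu nu al f g : f != 0 -> g != 0 ->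
  (forall be, Pge mu be f = Pge nu (be - al) g) -> mu f = nu g + al.
Proof.
move=> f0 g0 mu_nu; apply: le_anti; apply/andP; split.
  by have := Pge_value mu f; rewrite mu_nu filt_neq0 //= legBlDr.
by have := mu_nu (nu g + al); rewrite addrK Pge_value filt_neq0.
Qed.

Definition ultrametric mu := forall al f g, Pge mu al f -> Pge mu al g -> Pge mu al (f - g).

Definition eqmod mu al f g := Pgt mu al (f - g).

Lemma eqmod_refl mu al f : eqmod mu al f f.
Proof. by rewrite /eqmod subrr filt0. Qed.

Lemma eqmod0 mu al f : eqmod mu al f 0 = Pgt mu al f.
Proof. by rewrite /eqmod subr0. Qed.

Section Ultrametric.
Variable mu : A -> V.
Hypothesis muU : ultrametric mu.

Lemma filtB b al f g : filt b mu al f -> filt b mu al g -> filt b mu al (f - g).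
Proof.
case: b; first exact: muU.
have above be : al < be -> Pge mu be f -> Pge mu be g -> Pgt mu al (f - g).
  by move=> al_be be_f be_g; apply: Pge_lt al_be _; apply: muU.
case: (eqVneq g 0) (above (mu g)) => [->|g0 above_g]; first by rewrite subr0.
case: (eqVneq f 0) (above (mu f)) => [f0|f0 above_f].
  by move=> _ _; rewrite (filt_neq0 _ _ _ g0) => /above_g; apply; rewrite ?f0 ?filt0 ?Pge_value.
rewrite (filt_neq0 _ _ _ f0) (filt_neq0 _ _ _ g0) => al_f al_g.
case: (leP (mu f) (mu g)) => [fg|/ltW gf]; [apply: above_f | apply: above_g];
  by rewrite ?Pge_value // filt_neq0.
Qed.

Lemma filtN b al f : filt b mu al (- f) = filt b mu al f.
Proof.
have filt_opp g : filt b mu al g -> filt b mu al (- g).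
  by rewrite -[- g]sub0r; apply/filtB/filt0.
by apply/idP/idP => /filt_opp //; rewrite opprK.
Qed.

Lemma filtD b al f g : filt b mu al f -> filt b mu al g -> filt b mu al (f + g).
Proof. by rewrite -[g in f + g]opprK -(filtN b al g); apply: filtB. Qed.

Lemma filt_sum (I : Type) (s : seq I) (P : pred I) (F : I -> A) b al :
  (forall i, P i -> filt b mu al (F i)) -> filt b mu al (\sum_(i <- s | P i) F i).
Proof.
by move=> F_al; elim/big_ind: _ => [|f g|//]; [apply: filt0 | apply: filtD].
Qed.

Lemma eqmod_sym al f g : eqmod mu al f g = eqmod mu al g f.
Proof. by rewrite /eqmod -filtN opprB. Qed.

Lemma eqmod_trans g al f h : eqmod mu al f g -> eqmod mu al g h -> eqmod mu al f h.
Proof. by rewrite /eqmod => fg /(filtD fg); rewrite addrA subrK. Qed.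

Lemma eqmodD al f f' g g' :
  eqmod mu al f f' -> eqmod mu al g g' -> eqmod mu al (f + g) (f' + g').
Proof. by rewrite /eqmod opprD addrACA; apply: filtD. Qed.

Lemma eqmod_sum (I : Type) (s : seq I) (P : pred I) (F F' : I -> A) al :
  (forall i, P i -> eqmod mu al (F i) (F' i)) ->
  eqmod mu al (\sum_(i <- s | P i) F i) (\sum_(i <- s | P i) F' i).
Proof. by move=> FF'; rewrite /eqmod -sumrB; apply: filt_sum. Qed.

Lemma eqmod_Pge al f g : eqmod mu al f g -> Pge mu al f -> Pge mu al g.
Proof. by move=> /filt_Pge fg al_f; rewrite -[g](subKr f); apply: filtB. Qed.

Lemma eqmod_Pgt al f g : eqmod mu al f g -> Pgt mu al f = Pgt mu al g.
Proof.
by move=> fg; apply/idP/idP; rewrite -!eqmod0; apply: eqmod_trans; rewrite // eqmod_sym.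
Qed.

Lemma eqmod_value f g : f != 0 -> eqmod mu (mu f) f g -> g != 0 /\ mu g = mu f.
Proof.
move=> f0 fg; have g0 : g != 0.
  by apply: contraTneq fg => ->; rewrite eqmod0 PgtF.
split=> //; apply: value_eq => //.
  exact: eqmod_Pge fg (Pge_value mu f).
by apply/negP => /(filtD fg); rewrite subrK PgtF.
Qed.

End Ultrametric.
End Filtration.

Section RingFiltration.
Variables (A : nzRingType) (G : zmodType) (R : rel G) (oR : group_order R).
Local Notation V := (value_group oR).

Record ring_filtration (mu : A -> V) : Prop := RingFiltration {
  ring_filtration_ultrametric : ultrametric mu;
  PgeM : forall al be f g, Pge mu al f -> Pge mu be g -> Pge mu (al + be) (f * g)
}.

Variable mu : A -> V.
Hypothesis muF : ring_filtration mu.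
Implicit Types (al be : V) (b : bool) (f g : A).

Lemma filtM b al be f g : filt b mu al f -> Pge mu be g -> filt b mu (al + be) (f * g).
Proof.
case: b => [|al_f be_g]; first exact: PgeM.
have [->|f0] := eqVneq f 0; first by rewrite mul0r filt0.
apply: Pge_lt (PgeM muF (Pge_value mu f) be_g).
by move: al_f; rewrite filt_neq0 //= ltgD2r.
Qed.

Lemma filtMr b al be f g : Pge mu al f -> filt b mu be g -> filt b mu (al + be) (f * g).
Proof.
case: b => [|al_f be_g]; first exact: PgeM.
have [->|g0] := eqVneq g 0; first by rewrite mulr0 filt0.
apply: Pge_lt (PgeM muF al_f (Pge_value mu g)).
by move: be_g; rewrite filt_neq0 //= -(ltgD2r al) ![_ + al]addrC.
Qed.

Lemma eqmodM al be f f' g g' : Pge mu al f' -> Pge mu be g ->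
  eqmod mu al f f' -> eqmod mu be g g' -> eqmod mu (al + be) (f * g) (f' * g').
Proof.
rewrite /eqmod => al_f' be_g ff' gg'.
have -> : f * g - f' * g' = (f - f') * g + f' * (g - g').
  by rewrite mulrBl mulrBr addrA subrK.
by apply: (filtD (ring_filtration_ultrametric muF)); [apply: filtM | apply: filtMr].
Qed.

End RingFiltration.

Section Valuation.
Variables (A : idomainType) (G : zmodType) (R : rel G) (oR : group_order R).
Local Notation V := (value_group oR).

Record valuation (mu : A -> V) : Prop := Valuation {
  valueM : forall f g, f != 0 -> g != 0 -> mu (f * g) = mu f + mu g;
  valuation_ultrametric : ultrametric mu
}.

Variable mu : A -> V.
Hypothesis muV : valuation mu.
Implicit Types (al : V) (b : bool) (f g : A).

Lemma valuation_filtration : ring_filtration mu.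
Proof.
split=> [|al be f g]; first exact: (valuation_ultrametric muV).
have [->|f0] := eqVneq f 0; first by move=> *; rewrite mul0r filt0.
have [->|g0] := eqVneq g 0; first by move=> *; rewrite mulr0 filt0.
by rewrite !filt_neq0 ?mulf_neq0 // (valueM muV) //=; apply: legD.
Qed.

Lemma value1 : mu 1 = 0.
Proof. by apply: (addrI (mu 1)); rewrite -(valueM muV) ?oner_neq0 // mulr1 addr0. Qed.

Lemma valueX f n : f != 0 -> mu (f ^+ n) = mu f *+ n.
Proof.
move=> f0; elim: n => [|n IH]; first by rewrite expr0 value1.
by rewrite exprS mulrS (valueM muV) ?expf_neq0 // IH.
Qed.

Lemma filt_mull b al f g : f != 0 -> filt b mu (mu f + al) (f * g) = filt b mu al g.
Proof.
move=> f0; have [->|g0] := eqVneq g 0; first by rewrite mulr0 !filt0.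
by rewrite !filt_neq0 ?mulf_neq0 // (valueM muV) // lteifgD2l.
Qed.

End Valuation.

(** * Expansions and augmented valuations *)

Lemma subr_mul_divp (K : fieldType) (f p : {poly K}) : f - p * (f %/ p) = f %% p.
Proof. by rewrite {1}(divp_eq f p) mulrC addrAC subrr add0r. Qed.

Section Expansion.
Variables (K : fieldType) (p : {poly K}).
Hypothesis p_gt1 : (1 < size p)%N.
Implicit Types f g a b : {poly K}.

Lemma size_gt1_neq0 : p != 0.
Proof. by rewrite -size_poly_gt0 ltnW. Qed.

Lemma size_divp_lt f : f != 0 -> (size (f %/ p)%R < size f)%N.
Proof.
move=> f0; rewrite size_divp ?size_gt1_neq0 // ltn_subrL size_poly_gt0 f0 andbT.
by rewrite -ltnS prednK // ltnW.
Qed.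

Lemma poly_divp_ind (P : {poly K} -> Prop) :
  P 0 -> (forall f, f != 0 -> P (f %/ p) -> P f) -> forall f, P f.
Proof.
move=> P0 Pn f; have [n] := ubnP (size f); elim: n f => // n IH f sf.
have [->//|f0] := eqVneq f 0; apply: Pn => //; apply: IH.
exact: leq_trans (size_divp_lt f0) _.
Qed.

Lemma size_phiexp f : size (phiexp p f) = size f.
Proof.
have size_rec k g : size (phiexp_rec k p g) = k by elim: k g => //= k IH g; rewrite IH.
exact: size_rec.
Qed.

Lemma nth_phiexp_rec k f s : (s < k)%N -> nth 0 (phiexp_rec k p f) s = (f %/ p ^+ s) %% p.
Proof.
elim: k f s => // k IH f [|s] /= sk; first by rewrite expr0 divp1.
by rewrite IH // exprS divp_divl.
Qed.

Lemma ltn_size_exp s : (s < size (p ^+ s)%R)%N.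
Proof.
have := size_exp p s; have: (0 < size (p ^+ s)%R)%N.
  by rewrite size_poly_gt0 expf_neq0 // size_gt1_neq0.
case: (size (p ^+ s)) => //= n _ ->; rewrite ltnS leq_pmull //.
by rewrite -ltnS prednK // ltnW.
Qed.

Lemma coefsE f s : coefs p f s = (f %/ p ^+ s) %% p.
Proof.
have [sf|fs] := ltnP s (size f); first exact: nth_phiexp_rec.
rewrite /coefs nth_default ?size_phiexp // divp_small ?mod0p //.
exact: leq_ltn_trans fs (ltn_size_exp s).
Qed.

Lemma coefs_ge f s : (size f <= s)%N -> coefs p f s = 0.
Proof. by move=> fs; rewrite /coefs nth_default // size_phiexp. Qed.

Lemma coefs_size_gt f s : coefs p f s != 0 -> (s < size f)%N.
Proof. by rewrite ltnNge; apply: contra => /coefs_ge ->. Qed.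

Lemma size_coefs f s : (size (coefs p f s) < size p)%N.
Proof. by rewrite coefsE ltn_modp size_gt1_neq0. Qed.

Lemma coefs_neq0_ex f : f != 0 -> exists s, coefs p f s != 0.
Proof.
elim/poly_divp_ind: f => [|f f0 IH _]; first by rewrite eqxx.
have [m0|m0] := eqVneq (f %% p) 0; last by exists 0%N; rewrite coefsE divp1.
have [|s] := IH; last by exists s.+1; rewrite coefsE exprS -divp_divl -coefsE.
by apply: contraNneq f0 => d0; rewrite (divp_eq f p) d0 m0 mul0r addr0.
Qed.

Lemma coefs_zero s : coefs p 0 s = 0.
Proof. by rewrite coefs_ge ?size_poly0. Qed.

Lemma coefsB f g s : coefs p (f - g) s = coefs p f s - coefs p g s.
Proof. by rewrite !coefsE divpD modpD divpN modpN. Qed.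

Lemma coefsD f g s : coefs p (f + g) s = coefs p f s + coefs p g s.
Proof. by rewrite !coefsE divpD modpD. Qed.

Lemma coefs_sum (I : Type) (l : seq I) (P : pred I) (F : I -> {poly K}) s :
  coefs p (\sum_(i <- l | P i) F i) s = \sum_(i <- l | P i) coefs p (F i) s.
Proof.
apply: (big_morph (fun f => coefs p f s)) => [f g|]; [exact: coefsD | exact: coefs_zero].
Qed.

Lemma coefs_small a s : (size a < size p)%N -> coefs p a s = if s == 0%N then a else 0.
Proof.
move=> sa; rewrite coefsE; case: s => [|s]; first by rewrite divp1 modp_small.
by rewrite exprS -divp_divl (divp_small sa) div0p mod0p.
Qed.

Lemma coefs_mulX f n s : coefs p (f * p ^+ n) s = if (s < n)%N then 0 else coefs p f (s - n).
Proof.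
have pX0 k : p ^+ k != 0 by rewrite expf_neq0 // size_gt1_neq0.
rewrite !coefsE; have [sn|ns] := ltnP s n.
  by rewrite -(subnK sn) addnS exprS exprD mulrA mulrA mulpK // mulrAC modp_mull.
by rewrite -{1}(subnKC ns) exprD -divp_divl mulpK.
Qed.

Lemma coefs_monomial a n s : (size a < size p)%N ->
  coefs p (a * p ^+ n) s = if s == n then a else 0.
Proof.
move=> sa; rewrite coefs_mulX; case: ltngtP => [//|ns|->]; rewrite coefs_small ?subnn //.
by rewrite subn_eq0 leqNgt ns.
Qed.

Lemma coefs_modX f n s : coefs p (f %% p ^+ n) s = if (s < n)%N then coefs p f s else 0.
Proof.
have pX0 k : p ^+ k != 0 by rewrite expf_neq0 // size_gt1_neq0.
have [sn|ns] := ltnP s n.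
  by rewrite [in RHS](divp_eq f (p ^+ n)) coefsD coefs_mulX sn add0r.
rewrite coefsE divp_small ?mod0p // -(subnKC ns) exprD.
apply: leq_trans (_ : size (p ^+ n) <= _)%N; first by rewrite ltn_modp.
by rewrite dvdp_leq ?dvdp_mulr // mulf_neq0.
Qed.

Lemma size_divpM_small a b : (size a < size p)%N -> (size b < size p)%N ->
  (size ((a * b) %/ p)%R < size p)%N.
Proof.
move=> sa sb; rewrite size_divp ?size_gt1_neq0 //.
apply: leq_ltn_trans (leq_sub2r _ (size_polyMleq _ _)) _.
case: (size p) p_gt1 sa sb => // n n_gt0 sa sb; rewrite ltnS leq_subLR /=.
by apply: leq_trans (leq_pred _) _; apply: leq_add.
Qed.

End Expansion.

Lemma irreducible_poly_inverse (K : fieldType) (p a : {poly K}) : irreducible_poly p ->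
  a != 0 -> (size a < size p)%N ->
  exists b : {poly K}, [/\ b != 0, (size b < size p)%N & (a * b) %% p = 1].
Proof.
case=> p_gt1 p_irr a0 sa.
have /Bezout_eq1_coprimepP [[u v] /= uv] : coprimep a p.
  apply/coprimepP => d d_a d_p; rewrite -size_poly_eq1; apply/negPn/negP => /p_irr/(_ d_p).
  by move=> /eqp_size sd; have := dvdp_leq a0 d_a; rewrite sd leqNgt sa.
have au : (a * (u %% p)) %% p = 1.
  rewrite modp_mul mulrC -[RHS](modp_small (q := p)) ?size_poly1 //.
  by rewrite -uv modpD modp_mull addr0.
have p0 := size_gt1_neq0 p_gt1; exists (u %% p); rewrite ltn_modp p0; split=> //.
by apply: contra_eq_neq au => ->; rewrite mulr0 mod0p eq_sym oner_neq0.
Qed.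

(* What makes [nu; p, gm] a valuation: it only involves the restriction of nu
   to the polynomials of degree less than deg p, hence also applies to
   p = x + a and a valuation nu of K, extended in a meaningless way to K[x]. *)
Record augmentable (K : fieldType) (G : zmodType) (R : rel G) (oR : group_order R)
    (nu : {poly K} -> value_group oR) (p : {poly K}) (gm : value_group oR) : Prop := Augmentable {
  augmentable_size : (1 < size p)%N;
  augmentableB : forall al (a a' : {poly K}), (size a < size p)%N -> (size a' < size p)%N ->
    Pge nu al a -> Pge nu al a' -> Pge nu al (a - a');
  augmentableM : forall a a' : {poly K}, a != 0 -> a' != 0 ->
    (size a < size p)%N -> (size a' < size p)%N ->
    [/\ (a * a') %% p != 0, nu ((a * a') %% p) = nu a + nu a' &
        Pgt nu (nu a + nu a' - gm) ((a * a') %/ p)]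
}.

Lemma augmentable_XaddC (K : fieldType) (G : zmodType) (R : rel G) (oR : group_order R)
    (v : K -> value_group oR) (c : K) (gm : value_group oR) : valuation v ->
  augmentable (fun f : {poly K} => v f`_0) ('X + c%:P) gm.
Proof.
move=> v_val; have small (a : {poly K}) : (size a < 2)%N -> exists d, a = d%:P.
  by move=> sa; exists a`_0; apply: size1_polyC.
have const b al d : filt b (fun f : {poly K} => v f`_0) al d%:P = filt b v al d.
  have [->|d0] := eqVneq d 0; first by rewrite !filt0.
  by rewrite !filt_neq0 ?polyC_eq0 // coefC.
split; rewrite size_XaddC //.
  move=> al a a' /small[d ->] /small[d' ->].
  by rewrite -polyCB !const; apply: (valuation_ultrametric v_val).
move=> a a' a0 a'0 /small[d ad] /small[d' ad']; move: a0 a'0.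
rewrite ad ad' !polyC_eq0 -polyCM => d0 d'0.
have sm : (size (d * d')%:P < size ('X + c%:P)%R)%N by rewrite size_XaddC ltnS size_polyC_leq1.
rewrite modp_small // divp_small // filt0 polyC_eq0 mulf_neq0 //= !coefC /=.
by rewrite (valueM v_val).
Qed.

Section Augmentation.
Variables (K : fieldType) (G : lmodType rat) (C : chain K G) (oC : group_order (le C)).
Local Notation V := (value_group oC).
Variables (nu : {poly K} -> V) (p : {poly K}) (gm : V).
Local Notation mu := (augment C nu p gm : {poly K} -> V).
Implicit Types (f g a : {poly K}) (al be : V) (b : bool) (s : nat).

Hypothesis aug : augmentable nu p gm.
Let p_gt1 := augmentable_size aug.

Definition attained f s := (coefs p f s != 0) && (nu (coefs p f s) + gm *+ s == mu f).

Lemma attained_value f s : attained f s -> nu (coefs p f s) + gm *+ s = mu f.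
Proof. by case/andP => _ /eqP. Qed.

Lemma attained_size f s : attained f s -> (s < size f)%N.
Proof. by case/andP => /coefs_size_gt. Qed.

Lemma attained_ex f : f != 0 -> exists s, attained f s.
Proof.
move=> /(coefs_neq0_ex p_gt1) [s0 cs0]; rewrite /attained /augment; set l := map _ _.
have : gminl C l \in l.
  apply: (gminl_in (oC := oC)); apply/eqP => l0.
  suff : (nu (coefs p f s0) + gm *+ s0 : V) \in l by rewrite l0.
  by apply: map_f; rewrite mem_filter cs0 mem_iota size_phiexp; apply: coefs_size_gt cs0.
by case/mapP => s; rewrite mem_filter => /andP[cs _] ->; exists s; rewrite cs /=.
Qed.

Lemma augment_le f s : coefs p f s != 0 -> mu f <= nu (coefs p f s) + gm *+ s.
Proof.
move=> cs; apply: gminl_le; apply: map_f.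
by rewrite mem_filter cs mem_iota size_phiexp; apply: coefs_size_gt cs.
Qed.

Lemma filt_augmentP b al f :
  reflect (forall s, filt b nu (al - gm *+ s) (coefs p f s)) (filt b mu al f).
Proof.
have [->|f0] := eqVneq f 0.
  by rewrite filt0; left => s; rewrite coefs_zero filt0.
rewrite filt_neq0 //; apply: (iffP idP) => [al_f s|al_f].
  have [->|cs] := eqVneq (coefs p f s) 0; first exact: filt0.
  rewrite filt_neq0 // lteifgBlDr; case: b al_f => /= al_f.
    exact: le_trans (augment_le cs).
  exact: lt_le_trans (augment_le cs).
have [s att_s] := attained_ex f0; have /andP[cs _] := att_s.
by have := al_f s; rewrite filt_neq0 // lteifgBlDr attained_value.
Qed.

Lemma filt_augment_divmod b al f :
  filt b mu al f = filt b nu al (f %% p) && filt b mu (al - gm) (f %/ p).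
Proof.
have coefs0 g : coefs p g 0 = g %% p by rewrite coefsE // divp1.
have coefsS g s : coefs p g s.+1 = coefs p (g %/ p) s by rewrite !coefsE // exprS divp_divl.
apply/filt_augmentP/andP => [al_f|[al_m /filt_augmentP al_d] [|s]].
- split; first by have := al_f 0%N; rewrite coefs0 subr0.
  by apply/filt_augmentP => s; have := al_f s.+1; rewrite coefsS mulrS opprD addrA.
- by rewrite coefs0 subr0.
- by rewrite coefsS mulrS opprD addrA.
Qed.

Lemma filt_augment_small b al a : (size a < size p)%N -> filt b mu al a = filt b nu al a.
Proof. by move=> sa; rewrite filt_augment_divmod modp_small // divp_small // filt0 andbT. Qed.

Lemma filt_augmentMp b al f : filt b mu al (f * p) = filt b mu (al - gm) f.
Proof. by rewrite filt_augment_divmod modp_mull mulpK ?size_gt1_neq0 // filt0. Qed.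

Lemma augment_small a : a != 0 -> (size a < size p)%N -> mu a = nu a.
Proof.
move=> a0 sa; rewrite -[RHS]addr0; apply: value_eq_Pge => // be.
by rewrite subr0 filt_augment_small.
Qed.

Lemma augmentMp f : f != 0 -> mu (f * p) = mu f + gm.
Proof.
move=> f0; apply: value_eq_Pge => // [|be]; rewrite ?filt_augmentMp //.
by rewrite mulf_neq0 // size_gt1_neq0.
Qed.

Lemma augment_ultrametric : ultrametric mu.
Proof.
move=> al f g /filt_augmentP al_f /filt_augmentP al_g; apply/filt_augmentP => s.
by rewrite coefsB //; apply: (augmentableB aug); rewrite ?size_coefs.
Qed.

Lemma augment_PgeM_small al be a a' : (size a < size p)%N -> (size a' < size p)%N ->
  Pge mu al a -> Pge mu be a' -> Pge mu (al + be) (a * a').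
Proof.
move=> sa sa'; have [->|a0] := eqVneq a 0; first by move=> *; rewrite mul0r filt0.
have [->|a'0] := eqVneq a' 0; first by move=> *; rewrite mulr0 filt0.
rewrite (filt_augment_small _ _ sa) (filt_augment_small _ _ sa').
rewrite (filt_neq0 _ _ _ a0) (filt_neq0 _ _ _ a'0) /= => al_a be_a'.
rewrite filt_augment_divmod filt_augment_small ?size_divpM_small //.
have [m0 vm d_gt] := augmentableM aug a0 a'0 sa sa'.
rewrite (filt_neq0 _ _ _ m0) vm /= legD //=.
by apply: filt_Pge (filt_le _ d_gt); rewrite legD2r legD.
Qed.

Lemma augment_filtration : ring_filtration mu.
Proof.
split=> [|al be f g]; first exact: augment_ultrametric.
have sm h : (size (h %% p)%R < size p)%N by rewrite ltn_modp size_gt1_neq0.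
have small_mul a al' be' h : (size a < size p)%N ->
    Pge mu al' a -> Pge mu be' h -> Pge mu (al' + be') (a * h).
  move=> sa al_a; elim/(poly_divp_ind p_gt1): h be' => [|h _ IH] be'.
    by rewrite mulr0 !filt0.
  rewrite filt_augment_divmod => /andP[be_m be_d].
  rewrite [h](divp_eq h p) mulrDr; apply: (filtD augment_ultrametric); last first.
    by apply: augment_PgeM_small; rewrite // filt_augment_small.
  by rewrite mulrA filt_augmentMp -addrA; apply: IH.
elim/(poly_divp_ind p_gt1): f al => [|f _ IH] al al_f be_g; first by rewrite mul0r filt0.
move: al_f; rewrite filt_augment_divmod => /andP[al_m al_d].
rewrite [f](divp_eq f p) mulrDl; apply: (filtD augment_ultrametric); last first.
  by apply: small_mul; rewrite // filt_augment_small.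
by rewrite mulrAC filt_augmentMp addrAC; apply: IH.
Qed.

Lemma first_attained_ex f : f != 0 ->
  exists2 s, attained f s & forall t, attained f t -> (s <= t)%N.
Proof. by move=> /attained_ex f_ex; case: (ex_minnP f_ex) => s; exists s. Qed.

Lemma Pgt_not_attained f s : ~~ attained f s -> Pgt nu (mu f - gm *+ s) (coefs p f s).
Proof.
rewrite /attained; have [->|cs] := eqVneq (coefs p f s) 0; first by rewrite filt0.
by rewrite /= filt_neq0 // lteifgBlDr /= lt_neqAle augment_le // andbT eq_sym.
Qed.

Lemma augment_eqmod_divX f s : (forall t, attained f t -> (s <= t)%N) ->
  eqmod mu (mu f) f (f %/ p ^+ s * p ^+ s).
Proof.
move=> min_s; rewrite /eqmod mulrC subr_mul_divp.
apply/filt_augmentP => t; rewrite coefs_modX //; case: ltnP => [ts|_]; last exact: filt0.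
by apply: Pgt_not_attained; apply/negP => /min_s; rewrite leqNgt ts.
Qed.

Lemma augment_eqmod_sum f (l : seq nat) : uniq l -> (forall s, attained f s -> s \in l) ->
  eqmod mu (mu f) f (\sum_(s <- l | attained f s) coefs p f s * p ^+ s).
Proof.
move=> l_uniq att_l; apply/filt_augmentP => t; rewrite coefsB // coefs_sum //.
under eq_bigr do rewrite coefs_monomial ?size_coefs // eq_sym.
have [att_t|natt_t] := boolP (attained f t).
  rewrite big_mkcond (bigD1_seq t) ?att_l //= att_t eqxx.
  rewrite big1 ?addr0 ?subrr ?filt0 // => s /negbTE; rewrite eq_sym => ->.
  by rewrite if_same.
rewrite big1 ?subr0; first exact: Pgt_not_attained.
by move=> s att_s; case: eqP => // st; rewrite -st att_s in natt_t.
Qed.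

(* The product of the first terms of least value of f and g is a term of
   least value of f g. *)
Lemma augment_valuation : valuation mu.
Proof.
split; last exact: augment_ultrametric.
move=> f g f0 g0; apply: value_eq; first exact: mulf_neq0.
  by apply: (PgeM augment_filtration); apply: Pge_value.
have [s att_s /augment_eqmod_divX fs] := first_attained_ex f0.
have [t att_t /augment_eqmod_divX gt] := first_attained_ex g0.
have [cs ct] : coefs p f s != 0 /\ coefs p g t != 0.
  by case/andP: att_s; case/andP: att_t.
have := eqmodM augment_filtration (eqmod_Pge augment_ultrametric fs (Pge_value mu f))
  (Pge_value mu g) fs gt.
move=> /(eqmod_Pgt augment_ultrametric) ->; rewrite mulrACA -exprD.
apply/negP => /filt_augmentP/(_ (s + t)%N).
rewrite coefs_mulX // ltnn subnn coefsE // divp1 -modp_mul mulrC -modp_mul mulrC -!coefsE //.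
have [m0 vm _] := augmentableM aug cs ct (size_coefs p_gt1 f s) (size_coefs p_gt1 g t).
rewrite filt_neq0 // vm -(attained_value att_s) -(attained_value att_t).
by rewrite mulrnDr addrACA addrK /= ltxx.
Qed.

End Augmentation.

(** * Graded algebras and key polynomials *)

Local Notation gcomp := Defs.comp.

Section GradedAlgebra.
Variables (K : fieldType) (G : lmodType rat) (C : chain K G) (oC : group_order (le C)).
Local Notation V := (value_group oC).
Variable mu : {poly K} -> V.
Implicit Types (a b : gr K G) (f g h : {poly K}) (al be : V).

Lemma comp_single al f be : gcomp [:: (al, f)] be = if be == al then f else 0.
Proof. by rewrite /gcomp big_cons big_nil /= eq_sym addr0; case: ifP. Qed.

Lemma comp_cat a b be : gcomp (a ++ b) be = gcomp a be + gcomp b be.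
Proof. by rewrite /gcomp big_cat. Qed.

Lemma comp_gmul a b be : gcomp (gmul a b) be = \sum_(x <- a) x.2 * gcomp b (be - x.1).
Proof.
rewrite /gcomp /gmul big_mkcond big_allpairs_dep /=; apply: eq_bigr => x _.
rewrite -big_mkcond mulr_sumr /=; apply: eq_bigl => y.
by rewrite [RHS]eq_sym subr_eq eq_sym addrC.
Qed.

Lemma comp_gmulC a b be : gcomp (gmul a b) be = gcomp (gmul b a) be.
Proof.
rewrite /gcomp /gmul [LHS]big_mkcond [RHS]big_mkcond !big_allpairs_dep /= exchange_big /=.
by apply: eq_bigr => y _; apply: eq_bigr => x _; rewrite addrC mulrC.
Qed.

Lemma comp_Hmu f be : gcomp (Hmu mu f) be = if be == mu f then f else 0.
Proof.
rewrite /Hmu; have [->|_] := eqVneq f 0; last exact: comp_single.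
by rewrite /gcomp big_nil if_same.
Qed.

Lemma comp_gmul_Hmu h a be : gcomp (gmul (Hmu mu h) a) be = h * gcomp a (be - mu h).
Proof.
rewrite comp_gmul /Hmu; have [->|_] := eqVneq h 0; first by rewrite big_nil mul0r.
by rewrite big_cons big_nil addr0.
Qed.

Lemma valid_Hmu f : valid C mu (Hmu mu f).
Proof.
rewrite /Hmu; have [//|_] := eqVneq f 0.
by rewrite /valid /= andbT; apply: (Pge_value mu f).
Qed.

Lemma greqP a b : greq C mu a b <-> forall be, eqmod mu be (gcomp a be) (gcomp b be).
Proof.
split=> ab be; first by apply/orP; case: (ab be) => [/eqP|]; [left | right].
by case/orP: (ab be) => [/eqP|]; [left | right].
Qed.

Lemma mu_divP h g : valuation mu -> h != 0 -> g != 0 ->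
  mu_div C mu h g <-> exists c, eqmod mu (mu g) g (h * c).
Proof.
move=> muV h0 g0; have muU := valuation_ultrametric muV; split.
  case=> c [_ /greqP/(_ (mu g))]; rewrite comp_gmul_Hmu comp_Hmu eqxx (eqmod_sym muU).
  by exists (gcomp c (mu g - mu h)).
case=> c gc; have [hc0 v_hc] := eqmod_value muU g0 gc.
have c0 : c != 0 by apply: contraNneq hc0 => ->; rewrite mulr0.
exists [:: (mu g - mu h, c)]; split.
  rewrite /valid /= andbT; suff -> : mu g - mu h = mu c by apply: (Pge_value mu c).
  by rewrite -v_hc (valueM muV) // addrAC subrr add0r.
apply/greqP => be; rewrite comp_gmul_Hmu comp_Hmu comp_single (inj_eq (addIr _)).
by case: eqP => [->|_]; rewrite ?mulr0 ?eqmod_refl // (eqmod_sym muU).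
Qed.

End GradedAlgebra.

Section InitialUnits.
Variables (A : idomainType) (G : zmodType) (R : rel G) (oR : group_order R).
Variable mu : A -> value_group oR.
Hypothesis muV : valuation mu.
Let muU := valuation_ultrametric muV.
Let muF := valuation_filtration muV.
Implicit Types f g : A.

(* The initial form H_mu(f) is a unit of G_mu. *)
Definition init_unit f := exists g, eqmod mu 0 (f * g) 1.

Lemma init_unit_inverse f g : eqmod mu 0 (f * g) 1 -> [/\ f != 0, g != 0 & mu g = - mu f].
Proof.
rewrite (eqmod_sym muU) -(value1 muV).
move=> /(eqmod_value muU (oner_neq0 _)) [+ v_fg]; rewrite mulf_eq0 negb_or => /andP[f0 g0].
by split=> //; apply: (addrI (mu f)); rewrite -(valueM muV) // v_fg (value1 muV) subrr.
Qed.

Lemma init_unit_neq0 f : init_unit f -> f != 0.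
Proof. by case=> g /init_unit_inverse[]. Qed.

Lemma init_unit1 : init_unit 1.
Proof. by exists 1; rewrite mulr1 eqmod_refl. Qed.

Lemma init_unitM f g : init_unit f -> init_unit g -> init_unit (f * g).
Proof.
case=> f' ff' [g' gg']; exists (f' * g'); have [_ _ v_g'] := init_unit_inverse gg'.
rewrite mulrACA -[0]addr0 -[X in eqmod _ _ _ X]mulr1; apply: (eqmodM muF) => //.
  by rewrite -(value1 muV) Pge_value.
have := PgeM muF (Pge_value mu g) (Pge_value mu g').
by rewrite v_g' subrr.
Qed.

End InitialUnits.

Section KeyPolynomial.
Variables (K : fieldType) (G : lmodType rat) (C : chain K G) (oC : group_order (le C)).
Local Notation V := (value_group oC).
Variables (mu : {poly K} -> V) (p : {poly K}).
Hypotheses (muV : valuation mu) (p_key : key_poly C mu p).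
Let muU := valuation_ultrametric muV.
Let muF := valuation_filtration muV.
Implicit Types (f g a b c : {poly K}) (al : V).

Lemma key_poly_neq0 : p != 0.
Proof. by case: p_key => /monic_neq0. Qed.

Lemma key_poly_size_gt1 : (1 < size p)%N.
Proof.
case: p_key => p_monic [[_ [not_unit _]] _]; rewrite ltnNge; apply/negP => sp.
have p1 : p = 1 by move: p_monic; rewrite (size1_polyC sp) monicE lead_coefC => /eqP ->.
apply: not_unit; exists (Hmu mu 1); split; first exact: valid_Hmu.
apply/greqP => be; rewrite p1 comp_gmul_Hmu mul1r comp_Hmu (value1 muV) subr0.
by rewrite comp_single eqmod_refl.
Qed.

Lemma key_poly_minimal f c : f != 0 -> (size f < size p)%N -> ~~ eqmod mu (mu f) f (p * c).
Proof.
move=> f0 sf; apply/negP => fc; case: p_key => _ [_ /(_ f f0 sf)]; apply.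
by apply/(mu_divP muV key_poly_neq0 f0); exists c.
Qed.

Lemma key_poly_prime a b c : a != 0 -> b != 0 -> (size a < size p)%N -> (size b < size p)%N ->
  ~~ eqmod mu (mu (a * b)) (a * b) (p * c).
Proof.
move=> a0 b0 sa sb; apply/negP => abc; case: p_key => _ [[_ [_ prime]] p_min].
have HM : gmul (Hmu mu a) (Hmu mu b) = Hmu mu (a * b).
  by rewrite /Hmu (negbTE a0) (negbTE b0) (negbTE (mulf_neq0 a0 b0)) (valueM muV).
have [] := prime _ _ (valid_Hmu mu a) (valid_Hmu mu b); [|exact: p_min|exact: p_min].
by rewrite HM; apply/(mu_divP muV key_poly_neq0 (mulf_neq0 a0 b0)); exists c.
Qed.

Lemma key_poly_irreducible : irreducible_poly p.
Proof.
split; first exact: key_poly_size_gt1.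
move=> d sd d_p; rewrite /eqp d_p /=; apply/negPn/negP => not_pd.
have p0 := key_poly_neq0; have d0 : d != 0 by apply: contraTneq d_p => ->; rewrite dvd0p.
have k0 : p %/ d != 0 by apply: contraNneq p0 => k0; rewrite -(divpK d_p) k0 mul0r.
have sd_lt : (size d < size p)%N.
  rewrite ltn_neqAle dvdp_leq // andbT; apply: contra not_pd.
  by rewrite (dvdp_size_eqp d_p) => /andP[].
have sk_lt : (size (p %/ d)%R < size p)%N.
  by apply: size_divp_lt p0; rewrite ltn_neqAle eq_sym sd size_poly_gt0.
by have := key_poly_prime 1 k0 d0 sk_lt sd_lt; rewrite divpK // mulr1 eqmod_refl.
Qed.

Lemma key_poly_Pge_mod al f : Pge mu al f -> Pge mu al (f %% p).
Proof.
move=> al_f; have [->|m0] := eqVneq (f %% p) 0; first exact: filt0.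
rewrite filt_neq0 //= leNgt; apply/negP => lt_al.
have/negP := key_poly_minimal (- (f %/ p)) m0 (etrans (ltn_modp _ _) key_poly_neq0); apply.
have -> : eqmod mu (mu (f %% p)) (f %% p) (p * - (f %/ p)) = Pgt mu (mu (f %% p)) f.
  by rewrite /eqmod mulrN opprK addrC [p * _]mulrC -divp_eq.
exact: Pge_lt lt_al al_f.
Qed.

Lemma key_poly_Pge_div al f : Pge mu al f -> Pge mu (al - mu p) (f %/ p).
Proof.
move=> al_f; have := filtB muU al_f (key_poly_Pge_mod al_f).
rewrite {1}[f](divp_eq f p) addrK mulrC => al_pq.
by rewrite -(filt_mull muV _ _ _ key_poly_neq0) subrKC.
Qed.

Variable gm : V.
Hypothesis gm_gt : mu p < gm.

Lemma key_poly_augmentable : augmentable mu p gm.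
Proof.
split; [exact: key_poly_size_gt1 | by move=> *; apply: muU |].
move=> a b a0 b0 sa sb.
have not_gt : ~~ Pgt mu (mu (a * b)) ((a * b) %% p).
  by rewrite -subr_mul_divp; apply: key_poly_prime.
have m0 : (a * b) %% p != 0 by apply: contraNneq not_gt => ->; apply: filt0.
rewrite -(valueM muV) //; split=> //.
  by apply: value_eq => //; apply/key_poly_Pge_mod/Pge_value.
apply: Pge_lt (key_poly_Pge_div (Pge_value mu (a * b))).
by rewrite ltgD2l ltgN2.
Qed.

Local Notation mu' := (augment C mu p gm : {poly K} -> V).

Lemma key_poly_augment_valuation : valuation mu'.
Proof. exact: augment_valuation key_poly_augmentable. Qed.

Let mu'U := valuation_ultrametric key_poly_augment_valuation.
Let mu'F := valuation_filtration key_poly_augment_valuation.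

Lemma key_poly_filt_augment (b : bool) al f : filt b mu al f -> filt b mu' al f.
Proof.
have Pge_augment be g : Pge mu be g -> Pge mu' be g.
  elim/(poly_divp_ind key_poly_size_gt1): g be => [|g _ IH] be be_g; first exact: filt0.
  rewrite (filt_augment_divmod key_poly_augmentable) key_poly_Pge_mod //=.
  apply: filt_le (IH _ (key_poly_Pge_div be_g)).
  by rewrite legD2l legN2 ltW.
case: b => [|/orP[/eqP -> | lt_al]]; [exact: Pge_augment | exact: filt0 |].
exact: Pge_lt lt_al (Pge_augment _ _ (Pge_value mu f)).
Qed.

Lemma key_poly_augment_eqmod_modp al f : Pge mu al f -> eqmod mu' al f (f %% p).
Proof.
move=> al_f; rewrite /eqmod {1}(divp_eq f p) addrK (filt_augmentMp key_poly_augmentable).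
apply: Pge_lt (key_poly_filt_augment (key_poly_Pge_div al_f)).
by rewrite ltgD2l ltgN2.
Qed.

Lemma not_mu_div_modp f : f != 0 -> ~ mu_div C mu p f ->
  [/\ f %% p != 0, mu (f %% p) = mu f & mu' f = mu f].
Proof.
move=> f0 not_div; have not_gt : ~~ Pgt mu (mu f) (f %% p).
  apply/negP => m_gt; apply: not_div; apply/(mu_divP muV key_poly_neq0 f0).
  by exists (f %/ p); rewrite /eqmod subr_mul_divp.
have m0 : f %% p != 0 by apply: contraNneq not_gt => ->; apply: filt0.
have vm : mu (f %% p) = mu f by apply: value_eq => //; apply/key_poly_Pge_mod/Pge_value.
split=> //; apply: value_eq (key_poly_filt_augment (Pge_value mu f)) _ => //.
by rewrite (filt_augment_divmod key_poly_augmentable) -vm PgtF.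
Qed.

Lemma init_unit_not_mu_div f : f != 0 -> ~ mu_div C mu p f -> init_unit mu' f.
Proof.
move=> f0 not_div; have [m0 vm _] := not_mu_div_modp f0 not_div.
have sm : (size (f %% p)%R < size p)%N by rewrite ltn_modp key_poly_neq0.
have [b [b0 sb mb]] := irreducible_poly_inverse key_poly_irreducible m0 sm.
have [_ v_mb _] := augmentableM key_poly_augmentable m0 b0 sm sb.
rewrite mb (value1 muV) vm in v_mb.
have mu_mb : Pge mu 0 (f %% p * b).
  by rewrite v_mb; apply: (PgeM muF); rewrite -?vm Pge_value.
exists b; apply: (eqmod_trans mu'U) (_ : eqmod mu' 0 (f %% p * b) 1); last first.
  by rewrite -mb; apply: key_poly_augment_eqmod_modp.
rewrite v_mb; apply: (eqmodM mu'F); last exact: eqmod_refl.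
- by apply: key_poly_filt_augment; rewrite -vm Pge_value.
- exact: key_poly_filt_augment (Pge_value mu b).
- exact: key_poly_augment_eqmod_modp (Pge_value mu f).
Qed.

Lemma init_unit_augment f : init_unit mu f -> init_unit mu' f /\ mu' f = mu f.
Proof.
case=> g fg; have fg' : eqmod mu' 0 (f * g) 1 by apply: key_poly_filt_augment.
have [f0 g0 v_g] := init_unit_inverse muV fg.
have [_ _ v'_g] := init_unit_inverse key_poly_augment_valuation fg'.
split; first by exists g.
have := key_poly_filt_augment (Pge_value mu f); have := key_poly_filt_augment (Pge_value mu g).
rewrite !filt_neq0 //= v_g v'_g legN2 => fle lef.
by apply: (@le_anti _ V); rewrite fle.
Qed.

End KeyPolynomial.

(** * Subgroups of the value group *)

Section Subgroup.
Variable V : zmodType.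

Definition subgroup (A : V -> Prop) := A 0 /\ forall x y, A x -> A y -> A (x - y).

Variable A : V -> Prop.
Hypothesis A_sub : subgroup A.

Lemma subgroupN x : A x -> A (- x).
Proof. by case: A_sub => A0 AB Ax; rewrite -sub0r; apply: AB. Qed.

Lemma subgroupD x y : A x -> A y -> A (x + y).
Proof. by move=> Ax Ay; rewrite -[y]opprK; apply: A_sub.2 => //; apply: subgroupN. Qed.

Lemma subgroup_mulrz x (n : int) : A x -> A (x *~ n).
Proof.
move=> Ax; have Amul m : A (x *+ m).
  by elim: m => [|m IH]; rewrite ?mulr0n ?mulrS; [apply: A_sub.1 | apply: subgroupD].
by case: n => n; rewrite ?NegzE ?mulrNz; [apply: Amul | apply/subgroupN/Amul].
Qed.

Lemma subgroup_sum n (F : nat -> V) : (forall j, (j < n)%N -> A (F j)) -> A (\sum_(j < n) F j).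
Proof.
move=> AF; elim/big_ind: _ => [|x y|j _]; [exact: A_sub.1 | exact: subgroupD | exact: AF].
Qed.

End Subgroup.

Section IndexOfCyclicQuotient.
Variables (G : lmodType rat) (A B : G -> Prop) (x : G) (e : nat).
Hypotheses (A_sub : subgroup A) (B_gen : forall y, B y -> exists m : int, A (y - x *~ m)).
Hypothesis AB_index : index_is A B e.

(* Every class of B/A contains a multiple of x by a natural number less than d. *)
Lemma index_le_mulrn d : (0 < d)%N -> A (x *+ d) -> (e <= d)%N.
Proof.
move=> d_gt0 Axd; case: AB_index => b [Bb [b_inj _]].
have [c Ac] : exists c : 'I_e -> 'I_d, forall k : 'I_e, A (b k - x *+ c k).
  apply: (fin_all_exists (P := fun (k : 'I_e) (m : 'I_d) => A (b k - x *+ m))) => k.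
  have [m Am] := B_gen (Bb k (ltn_ord k)).
  have lt_d : (`|(m %% d)%Z| < d)%N.
    by rewrite -ltz_nat gez0_abs ?modz_ge0 ?ltz_pmod // -lt0n.
  exists (Ordinal lt_d); rewrite /= pmulrn gez0_abs ?modz_ge0 -?lt0n //.
  have := subgroupD A_sub Am (subgroup_mulrz A_sub (m %/ d)%Z Axd).
  rewrite pmulrn -mulrzA {1}(divz_eq m d) mulrzDr [d%:Z * _]mulrC opprD addrA.
  by rewrite addrAC subrK.
rewrite -(card_ord e) -(card_ord d); apply: (@leq_card _ _ c) => k l ckl.
apply/val_inj/(b_inj _ _ (ltn_ord k) (ltn_ord l)).
by have := A_sub.2 _ _ (Ac k) (Ac l); rewrite ckl opprB addrA subrK.
Qed.

Lemma index_dvd_mulrz (n : int) : (0 < e)%N -> A (x *+ e) -> A (x *~ n) -> (e %| n)%Z.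
Proof.
move=> e_gt0 Axe Axn; have Agcd : A (x *+ gcdn e `|n|).
  have [u [v uv]] := Bezoutz e%:Z n.
  rewrite pmulrn -[Posz _]/(gcdz e n) -uv mulrzDr ![_ * e%:Z]mulrC ![_ * n]mulrC !mulrzA.
  by apply: subgroupD => //; apply: subgroup_mulrz.
have gcd_gt0 : (0 < gcdn e `|n|)%N by rewrite gcdn_gt0 e_gt0.
have <- : gcdn e `|n| = e.
  by apply/eqP; rewrite eqn_leq index_le_mulrn // dvdn_leq // dvdn_gcdl.
exact: dvdn_gcdr.
Qed.

End IndexOfCyclicQuotient.

(** * The valuations of a MacLane chain *)

Section Chain.
Variables (K : fieldType) (G : lmodType rat) (C : chain K G) (r : nat).
Hypothesis setup : MacLane_setup C r.
Implicit Types (f a : {poly K}) (x y : G) (i k : nat).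

Lemma setup_order : group_order (le C). Proof. by case: setup. Qed.

Local Notation V := (value_group setup_order).
Local Notation v := (Defs.val C : K -> V).
Local Notation mu k := (muc C k : {poly K} -> V).

Lemma val_valuation : valuation v.
Proof.
case: setup => _ [vM vD _ _] _ _ _; split=> // al a b.
have v1 : v 1 = 0 by apply: (addrI (v 1)); rewrite -vM ?oner_neq0 // mulr1 addr0.
have vN1 : v (- 1) = 0.
  have : v (- 1) *+ 2 = 0 by rewrite mulr2n -vM ?oppr_eq0 ?oner_neq0 // mulrNN mulr1.
  by move/eqP; rewrite -scaler_nat scaler_eq0 pnatr_eq0 => /eqP.
have [->|b0] := eqVneq b 0; first by rewrite subr0.
have vNb : v (- b) = v b by rewrite -mulN1r vM ?oppr_eq0 ?oner_neq0 // vN1 add0r.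
have [->|a0] := eqVneq a 0; first by move=> _; rewrite sub0r !filt_neq0 ?oppr_eq0 // vNb.
have [->|ab0] := eqVneq (a - b) 0; first by rewrite filt0.
rewrite !filt_neq0 //= => al_a al_b.
have : (gmin C (v a) (v b) : V) <= v (a - b) by rewrite -vNb; apply: vD; rewrite ?oppr_eq0.
by apply: le_trans; rewrite (gmin_min (oC := setup_order)) le_min al_a.
Qed.

Lemma phi0_eq : exists a : K, phi C 0 = 'X + a%:P.
Proof. by case: setup => _ _ []. Qed.

Lemma phi_key i : (0 < i <= r)%N -> key_poly C (muc C i) (phi C i) /\ mu i (phi C i) < gam C i.
Proof. by case: setup => _ _ [_ key _ _] _ _; apply: key. Qed.

Lemma size_phi0 : size (phi C 0) = 2.
Proof. by have [c ->] := phi0_eq; rewrite size_XaddC. Qed.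

Lemma augmentable0 : augmentable (mu 0) (phi C 0) (gam C 0).
Proof. by have [c ->] := phi0_eq; apply: augmentable_XaddC val_valuation. Qed.

Lemma muc_augmentable i : (i <= r)%N -> augmentable (mu i) (phi C i) (gam C i).
Proof.
elim: i => [_|i IH ir]; first exact: augmentable0.
have [key gt] := phi_key (i := i.+1) ir.
by apply: key_poly_augmentable => //; apply: augment_valuation (IH (ltnW ir)).
Qed.

Lemma muc_valuation i : (i <= r)%N -> valuation (mu i.+1).
Proof. by move=> ir; apply: augment_valuation (muc_augmentable ir). Qed.

Lemma phi_neq0 i : (i <= r)%N -> phi C i != 0.
Proof. by move=> /muc_augmentable /augmentable_size /size_gt1_neq0. Qed.

Lemma muc_small i a : (i <= r)%N -> a != 0 -> (size a < size (phi C i))%N ->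
  muc C i.+1 a = muc C i a.
Proof. by move=> ir; apply: (augment_small (muc_augmentable ir)). Qed.

Lemma muc_polyC i (c : K) : (i <= r.+1)%N -> c != 0 -> muc C i c%:P = Defs.val C c.
Proof.
move=> + c0; elim: i => [|i IH] ir; first by rewrite /= coefC.
rewrite muc_small ?polyC_eq0 //; first exact: IH (ltnW ir).
exact: leq_ltn_trans (size_polyC_leq1 _) (augmentable_size (muc_augmentable ir)).
Qed.

Lemma muc_phi i : (i <= r)%N -> muc C i.+1 (phi C i) = gam C i.
Proof.
move=> ir; rewrite -[phi C i]mul1r [LHS](augmentMp (muc_augmentable ir)) ?oner_neq0 //.
by rewrite [X in X + _](value1 (muc_valuation ir)) add0r.
Qed.

Lemma init_unit_polyC k (c : K) : c != 0 -> init_unit (mu k) c%:P.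
Proof. by move=> c0; exists (c^-1)%:P; rewrite -polyCM mulfV // eqmod_refl. Qed.

Lemma init_unit_phi i k : (i < k <= r)%N ->
  init_unit (mu k.+1) (phi C i) /\ muc C k.+1 (phi C i) = gam C i.
Proof.
case/andP; elim: k => // k IH; rewrite ltnS leq_eqVlt => ik kr.
have muV := muc_valuation (ltnW kr); have [key gt] := phi_key (i := k.+1) kr.
case/predU1P: ik => [->|ik]; last first.
  have [unit <-] := IH ik (ltnW kr).
  exact: (init_unit_augment muV key gt unit).
have not_div : ~ mu_div C (muc C k.+1) (phi C k.+1) (phi C k).
  by case: setup => _ _ [_ _ + _] _ _; apply.
split; first exact: (init_unit_not_mu_div muV key gt (phi_neq0 (ltnW kr)) not_div).
have [_ _ same_value] := not_mu_div_modp muV key gt (phi_neq0 (ltnW kr)) not_div.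
by rewrite [LHS]same_value muc_phi // ltnW.
Qed.

Lemma subgroup_Gam : subgroup (Gam C).
Proof.
split; first by exists 1; rewrite oner_neq0 (value1 val_valuation).
move=> _ _ [a [a0 <-]] [b [b0 <-]]; have c0 : a / b != 0 by rewrite mulf_neq0 ?invr_eq0.
exists (a / b); split=> //.
by rewrite -[in RHS](divfK b0 a) [v (a / b * b)](valueM val_valuation) // addrK.
Qed.

Lemma subgroup_GamMu k : (k <= r.+1)%N -> subgroup (GamMu C k).
Proof.
case: k => [_|k kr]; first exact: subgroup_Gam.
split=> [|_ _ [a [b [a0 [b0 ->]]]] [c [d [c0 [d0 ->]]]]].
  by exists 1, 1; rewrite oner_neq0 subrr.
exists (a * d), (b * c); rewrite !mulf_neq0 //; do 2!split => //.
by rewrite !(valueM (muc_valuation kr)) // opprB opprD addrACA.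
Qed.

Lemma GamMu_muc k a : (k <= r)%N -> a != 0 -> (size a < size (phi C k))%N ->
  GamMu C k (muc C k a).
Proof.
case: k => [_ a0|k kr a0 _].
  rewrite size_phi0 => sa; move: a0; rewrite (size1_polyC sa) polyC_eq0 => c0.
  by exists a`_0; rewrite /= coefC.
by exists a, 1; rewrite oner_neq0 (value1 (muc_valuation (ltnW kr))) subr0.
Qed.

Lemma GamMu_Gam k x : (k <= r.+1)%N -> Gam C x -> GamMu C k x.
Proof.
case: k => [//|k] kr [c [c0 <-]]; exists c%:P, 1.
by rewrite oner_neq0 polyC_eq0 (value1 (muc_valuation kr)) subr0 muc_polyC.
Qed.

Lemma GamMu_gam i k : (i < k <= r.+1)%N -> GamMu C k (gam C i).
Proof.
case: k => // k; rewrite !ltnS => /andP[ik kr]; exists (phi C i), 1.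
rewrite oner_neq0 (value1 (muc_valuation kr)) subr0 phi_neq0 ?(leq_trans ik kr) //.
do 2!split => //; move: ik; rewrite leq_eqVlt => /predU1P[->|ik]; first by rewrite muc_phi.
by have [|_ ->] := @init_unit_phi i k; rewrite ?ik.
Qed.

Lemma subgroup_GamIdx k : subgroup (GamIdx C k).
Proof.
split=> [|_ _ [c [z ->]] [c' [z' ->]]].
  by exists (fun=> 0), (fun=> 0); rewrite !big1 ?addr0 // => *; rewrite mulr0z.
exists (fun j => c j - c' j), (fun j => z j - z' j).
rewrite opprD addrACA -!sumrB; congr (_ + _); apply: eq_bigr => j _; by rewrite mulrzBr.
Qed.

Lemma GamIdx_GamMu k x : (k <= r.+1)%N -> GamIdx C k x -> GamMu C k x.
Proof.
move=> kr [c [z ->]]; have GamMu_sub := subgroup_GamMu kr; apply: subgroupD => //.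
  apply: (subgroup_sum GamMu_sub (F := fun j => iota0 C j *~ c j)) => j jr.
  apply: (subgroup_mulrz GamMu_sub); apply: GamMu_Gam => //.
  by case: setup => _ _ _ [Gam_iota0 _ _] _; apply: Gam_iota0.
apply: (subgroup_sum GamMu_sub (F := fun i => gam C i *~ z i)) => i ik.
by apply: (subgroup_mulrz GamMu_sub); apply: GamMu_gam; rewrite ik.
Qed.

Lemma eidx_gt0 i : (i <= r)%N -> (0 < eidx C i)%N.
Proof. by move=> ir; case: setup => _ _ [_ _ _ /(_ i ir) []]. Qed.

Lemma GamIdx_hbig i : (i <= r)%N -> GamIdx C i (hbig C i).
Proof. by move=> ir; case: setup => _ _ _ [_ _ /(_ i ir)]. Qed.

Lemma GamMuS_cyclic i y : (i <= r)%N -> GamMu C i.+1 y ->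
  exists m : int, GamMu C i (y - gam C i *~ m).
Proof.
move=> ir [a [b [a0 [b0 ->]]]]; have aug := muc_augmentable ir.
have GamMu_sub := subgroup_GamMu (leqW ir).
have value f : f != 0 -> exists s : nat, GamMu C i (muc C i.+1 f - gam C i *~ s).
  move=> /(attained_ex aug) [s att_s]; exists s; have/andP[cs _] := att_s.
  rewrite -[muc _ _ f](attained_value att_s) addrK.
  exact: GamMu_muc (size_coefs (augmentable_size aug) f s).
have [[s Ms] [t Mt]] := (value _ a0, value _ b0); exists (s%:Z - t%:Z).
by have := GamMu_sub.2 _ _ Ms Mt; rewrite mulrzBr !opprD addrACA.
Qed.

Lemma eidx_dvd i (n : int) : (i <= r)%N -> GamMu C i (gam C i *~ n) -> (eidx C i %| n)%Z.
Proof.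
move=> ir; apply: (@index_dvd_mulrz _ _ (GamMu C i.+1)).
- exact: subgroup_GamMu (leqW ir).
- by move=> y; apply: GamMuS_cyclic.
- by case: setup => _ _ [_ _ _ /(_ i ir) []].
- exact: eidx_gt0.
- exact: GamIdx_GamMu (leqW ir) (GamIdx_hbig ir).
Qed.

Lemma GamIdx_gam_mulrz i (n : int) : (i <= r)%N ->
  GamMu C i (gam C i *~ n) -> GamIdx C i (gam C i *~ n).
Proof.
move=> ir /(eidx_dvd ir) /dvdzP[q ->]; rewrite mulrC mulrzA.
exact: (subgroup_mulrz (subgroup_GamIdx i) q (GamIdx_hbig ir)).
Qed.

End Chain.

(** * Bases of the groups Gamma_i *)

Lemma subgroup_unimodular (V : zmodType) (A : V -> Prop) (x y : V) (t u l l' : int) :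
  subgroup A -> l * u + l' * t = 1 -> A (x *~ t - y *~ u) -> A (x *~ l + y *~ l') -> A x /\ A y.
Proof.
move=> A_sub det1 AX AY; split.
  have -> : x = (x *~ t - y *~ u) *~ l' + (x *~ l + y *~ l') *~ u.
    rewrite -{1}[x]mulr1z -det1 mulrzBl !mulrzDl -!mulrzA mulrzDr [l' * u]mulrC.
    by rewrite [RHS]addrACA [_ + y *~ _]addrC subrr addr0 addrC [t * _]mulrC.
  by apply: subgroupD => //; apply: subgroup_mulrz.
have -> : y = (x *~ l + y *~ l') *~ t - (x *~ t - y *~ u) *~ l.
  rewrite -{1}[y]mulr1z -det1 mulrzBl !mulrzDl -!mulrzA mulrzDr [l * t]mulrC.
  by rewrite opprB [RHS]addrC addrA subrK [u * _]mulrC.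
by apply: A_sub.2; apply: subgroup_mulrz.
Qed.

Section IntegerSpan.
Variables (V : zmodType) (n : nat) (b : nat -> V).

Definition zspan (x : V) := exists c : nat -> int, x = \sum_(j < n) b j *~ c j.

Definition zfree :=
  forall c : nat -> int, \sum_(j < n) b j *~ c j = 0 -> forall j, (j < n)%N -> c j = 0.

Lemma subgroup_zspan : subgroup zspan.
Proof.
split=> [|_ _ [c ->] [d ->]].
  by exists (fun=> 0); rewrite big1 // => j _; rewrite mulr0z.
exists (fun j => c j - d j); rewrite -sumrB.
by apply: eq_bigr => j _; rewrite mulrzBr.
Qed.

Lemma zspan_mem j : (j < n)%N -> zspan (b j).
Proof.
move=> jn; exists (fun k => (k == j)%:Z); rewrite (bigD1 (Ordinal jn)) //= eqxx mulr1z.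
rewrite big1 ?addr0 // => k; rewrite -val_eqE /= => /negbTE ->; exact: mulr0z.
Qed.

Lemma zfree_inj (c d : nat -> int) : zfree ->
  \sum_(j < n) b j *~ c j = \sum_(j < n) b j *~ d j -> forall j, (j < n)%N -> c j = d j.
Proof.
move=> b_free cd j jn; apply/eqP; rewrite -subr_eq0.
rewrite (b_free (fun j => c j - d j)) //.
by under eq_bigr do rewrite mulrzBr; rewrite sumrB cd subrr.
Qed.

End IntegerSpan.

Section RationalFreeness.
Variables (V : lmodType rat) (n : nat).
Implicit Types b : nat -> V.

Definition qfree b :=
  forall c : nat -> rat, \sum_(j < n) c j *: b j = 0 -> forall j, (j < n)%N -> c j = 0.

Lemma qfree_zfree b : qfree b -> zfree n b.
Proof.
move=> b_free c c0 j jn; apply/eqP; rewrite -(intq_eq0 (c j)).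
rewrite (b_free (fun j => (c j)%:~R)) //.
by under eq_bigr do rewrite scaler_int.
Qed.

Lemma zfree_qfree b : zfree n b -> qfree b.
Proof.
move=> b_free c c0 j jn; pose D := \prod_(k < n) denq (c k).
have D0 : D%:~R != 0 :> rat.
  by rewrite intq_eq0; apply/prodf_neq0 => k _; apply: denq_neq0.
pose z k := numq (c k * D%:~R).
have zE k : (k < n)%N -> (z k)%:~R = c k * D%:~R.
  move=> kn; rewrite /z /D (bigD1 (Ordinal kn)) //= intrM mulrA.
  by rewrite -{1 3}(divq_num_den (c k)) divfK ?intq_eq0 ?denq_neq0 // -intrM numq_int.
have /b_free/(_ j jn) zj0 : \sum_(k < n) b k *~ z k = 0.
  rewrite -[RHS](scaler0 _ D%:~R) -[in RHS]c0 scaler_sumr; apply: eq_bigr => k _.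
  by rewrite -scaler_int zE // scalerA mulrC.
by apply: (mulIf D0); rewrite -zE // zj0 mul0r.
Qed.

Lemma qfree_triangular b b' (T : nat -> nat -> rat) :
  (forall m j, (m < j)%N -> T m j = 0) -> (forall j, (j < n)%N -> T j j != 0) ->
  (forall j, b' j = \sum_(m < n) T m j *: b m) -> qfree b -> qfree b'.
Proof.
move=> T_lower T_diag b'E b_free c c0.
have rows m : (m < n)%N -> \sum_(j < n) c j * T m j = 0.
  apply: (b_free (fun m => \sum_(j < n) c j * T m j)); rewrite -[RHS]c0.
  under eq_bigr do rewrite scaler_suml; under [RHS]eq_bigr do rewrite b'E scaler_sumr.
  by rewrite exchange_big /=; apply: eq_bigr => j _; apply: eq_bigr => i _; rewrite scalerA.
elim/ltn_ind => j IH jn; have := rows j jn.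
rewrite (bigD1 (Ordinal jn)) //= big1 ?addr0 => [/eqP|k kj].
  by rewrite mulf_eq0 (negbTE (T_diag j jn)) orbF => /eqP.
case: (ltngtP k j) => [kj'|jk|kj']; first by rewrite IH ?mul0r.
  by rewrite T_lower ?mulr0.
by case/eqP: kj; apply: val_inj.
Qed.

End RationalFreeness.

Section Bases.
Variables (K : fieldType) (G : lmodType rat) (C : chain K G) (r : nat).
Hypothesis setup : MacLane_setup C r.
Implicit Types (x y : G) (i j t : nat).
Local Notation zspanb i := (zspan (rk C) (iotab C i)).

Lemma ee_gt0 i j : (i < r)%N -> (j < rk C)%N -> (0 < ee C i j)%N.
Proof. by move=> ir jr; case: setup => _ _ _ _ [_ /(_ i j ir jr) []]. Qed.

Lemma ee_neq0 i j : (i < r)%N -> (j < rk C)%N -> (ee C i j)%:R != 0 :> rat.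
Proof. by move=> ir jr; rewrite pnatr_eq0 -lt0n ee_gt0. Qed.

Lemma dd_gt0 i j : (i < r)%N -> (j < rk C)%N -> (0 < dd C i j)%N.
Proof. by move=> ir jr; rewrite gcdn_gt0 ee_gt0. Qed.

Lemma bezout_ell i j : (i < r)%N -> (j < rk C)%N ->
  ll C i j * hh C i j * (eprime C i j)%:Z + ll' C i j * (ee C i j)%:Z = (dd C i j)%:Z.
Proof. by move=> ir jr; case: setup => _ _ _ _ [_ _ /(_ i j ir jr) []]. Qed.

Lemma eprimeSE i j : (eprime C i j.+1 = (eprime C i j %/ dd C i j) * ee C i j)%N.
Proof. by rewrite /= -/(dd C i j) muln_divA ?dvdn_gcdl // divn_mulAC ?dvdn_gcdr. Qed.

Lemma ee_dvd_eprime i t j : (t < j)%N -> (ee C i t %| eprime C i j)%N.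
Proof.
elim: j => // j IH; rewrite ltnS leq_eqVlt => /predU1P[->|/IH e_dvd].
  by rewrite eprimeSE dvdn_mull.
by rewrite /= dvdn_mulr.
Qed.

Definition gam_coef i m : rat := (hh C i m)%:~R / (ee C i m)%:R.

(* The value of phi_i pi_{i,1}^{-h_{i,1}/e_{i,1}} ... pi_{i,j-1}^{-h_{i,j-1}/e_{i,j-1}}. *)
Definition gam_tail i j : G := \sum_(j <= m < rk C) gam_coef i m *: iotab C i m.

Lemma gam_tailS i j : (j < rk C)%N ->
  gam_tail i j = gam_coef i j *: iotab C i j + gam_tail i j.+1.
Proof. by move=> jr; rewrite /gam_tail big_ltn. Qed.

Lemma gam_tail_split i j : (i < r)%N -> (j <= rk C)%N ->
  gam C i = \sum_(t < j) gam_coef i t *: iotab C i t + gam_tail i j.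
Proof.
move=> ir jr; case: setup => _ _ _ _ [/(_ i ir) -> _ _ _].
rewrite -(big_mkord xpredT (fun m => gam_coef i m *: iotab C i m)).
by rewrite (big_cat_nat (leq0n j) jr) /= big_mkord.
Qed.

Lemma gam_tail_eprimeS i j : (i < r)%N -> (j < rk C)%N ->
  gam_tail i j *+ eprime C i j *~ (ee C i j %/ dd C i j)%N -
    iotab C i j *~ ((eprime C i j %/ dd C i j)%N%:Z * hh C i j) =
  gam_tail i j.+1 *+ eprime C i j.+1.
Proof.
move=> ir jr; rewrite -pmulrn -mulrnA -[(_ * (_ %/ _))%N]/(eprime C i j.+1).
rewrite gam_tailS // mulrnDl addrAC -[RHS]add0r; congr (_ + _).
rewrite -scaler_nat -scaler_int scalerA -scalerBl eprimeSE /gam_coef natrM intrM -pmulrn.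
have ee0 := ee_neq0 ir jr; rewrite (_ : _ - _ = 0) ?scale0r //.
by field.
Qed.

Lemma iotabS_tail i j : (i < r)%N -> (j < rk C)%N ->
  iotab C i.+1 j =
    gam_tail i j *+ eprime C i j *~ ll C i j + iotab C i j *~ ll' C i j.
Proof.
move=> ir jr /=; rewrite -(big_mkord xpredT (fun m => Qcoef C i m j *: iotab C i m)).
rewrite (big_cat_nat (leq0n j) (ltnW jr)) /= big_nat big1 ?add0r; last first.
  by move=> m /andP[_ mj]; rewrite /Qcoef ltn_eqF // ltnNge ltnW //= scale0r.
have lower : \sum_(j.+1 <= m < rk C) Qcoef C i m j *: iotab C i m =
    gam_tail i j.+1 *+ eprime C i j *~ ll C i j.
  rewrite /gam_tail -sumrMnl mulrz_suml big_nat [RHS]big_nat; apply: eq_bigr => m /andP[jm _].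
  rewrite /Qcoef gtn_eqF // jm -scaler_nat -scaler_int !scalerA /gam_coef; congr (_ *: _).
  by rewrite !mulrA.
rewrite big_ltn // lower (gam_tailS _ jr) mulrnDl mulrzDl addrAC; congr (_ + _).
rewrite -scaler_nat -!scaler_int !scalerA -scalerDl /Qcoef eqxx; congr (_ *: _).
have ee0 := ee_neq0 ir jr; apply: (mulIf ee0).
rewrite divfK // /gam_coef pmulrn -(bezout_ell ir jr).
by rewrite intrD !intrM -!pmulrn; field.
Qed.

(* The exponents are those of phi_i, pi_{i,t} and pi_{i,j} in pi_{i+1,j}. *)
Lemma iotabS_value i j : (i < r)%N -> (j < rk C)%N ->
  iotab C i.+1 j = gam C i *~ (ll C i j * (eprime C i j)%:Z) +
    \sum_(t < j) iotab C i t *~ (- (ll C i j * (eprime C i j %/ ee C i t)%:Z * hh C i t)) +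
    iotab C i j *~ ll' C i j.
Proof.
move=> ir jr; rewrite iotabS_tail // (gam_tail_split ir (ltnW jr)); congr (_ + _).
rewrite [ll C i j * _]mulrC mulrzA -pmulrn mulrnDl mulrzDl addrAC -[LHS]add0r; congr (_ + _).
rewrite -sumrMnl mulrz_suml -big_split big1 //= => t _.
have ee0 := ee_neq0 ir (ltn_trans (ltn_ord t) jr).
rewrite -scaler_nat -!scaler_int !scalerA -scalerDl (_ : _ + _ = 0) ?scale0r //.
rewrite -{1}(divnK (ee_dvd_eprime i (ltn_ord t))) /gam_coef natrM mulrNz !intrM -pmulrn.
by field.
Qed.

Lemma zspan_iotabS_step i j : (i < r)%N -> (j < rk C)%N ->
  zspanb i.+1 (gam_tail i j.+1 *+ eprime C i j.+1) ->
  zspanb i.+1 (gam_tail i j *+ eprime C i j) /\ zspanb i.+1 (iotab C i j).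
Proof.
move=> ir jr tailS; have d0 := dd_gt0 ir jr.
apply: (subgroup_unimodular (t := (ee C i j %/ dd C i j)%N)
  (u := (eprime C i j %/ dd C i j)%N%:Z * hh C i j) (l := ll C i j) (l' := ll' C i j)).
- exact: subgroup_zspan.
- have dz : (dd C i j)%:Z != 0 by rewrite -lt0n.
  apply: (mulIf dz); rewrite mul1r -[RHS](bezout_ell ir jr).
  rewrite -[in RHS](divnK (dvdn_gcdl (ee C i j) (eprime C i j))).
  rewrite -[in X in _ = X + _](divnK (dvdn_gcdr (ee C i j) (eprime C i j))).
  by rewrite !PoszM -/(dd C i j); ring.
- by rewrite gam_tail_eprimeS.
- by rewrite -iotabS_tail //; apply: zspan_mem.
Qed.

Lemma zspan_iotabS i : (i < r)%N ->
  zspanb i.+1 (gam C i) /\ forall j, (j < rk C)%N -> zspanb i.+1 (iotab C i j).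
Proof.
move=> ir; have tail k : (k <= rk C)%N ->
    zspanb i.+1 (gam_tail i (rk C - k) *+ eprime C i (rk C - k)).
  elim: k => [_|k IH kr].
    by rewrite subn0 /gam_tail big_geq // mul0rn; apply: (subgroup_zspan _ _).1.
  have rkS : (rk C - k = (rk C - k.+1).+1)%N by rewrite subnSK.
  have lt_rk : (rk C - k.+1 < rk C)%N by rewrite -rkS leq_subr.
  by apply: (zspan_iotabS_step ir lt_rk _).1; rewrite -rkS; apply/IH/ltnW.
split=> [|j jr].
  by have := tail (rk C) (leqnn _); rewrite subnn (gam_tail_split ir (leq0n _)) big_ord0 add0r.
apply: (zspan_iotabS_step ir jr _).2.
by have := tail (rk C - j.+1)%N (leq_subr _ _); rewrite subKn.
Qed.

Lemma GamIdx_zspan i x : (i <= r)%N -> GamIdx C i x -> zspanb i x.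
Proof.
elim: i x => [|i IH] x ir [c [z ->]]; first by rewrite big_ord0 addr0; exists c.
have [span_gam span_iotab] := zspan_iotabS ir.
have zspan_sub := subgroup_zspan (rk C) (iotab C i.+1).
rewrite big_ord_recr /= addrA; apply: subgroupD => //; last exact: subgroup_mulrz.
have [d ->] : zspanb i (\sum_(j < rk C) iota0 C j *~ c j + \sum_(t < i) gam C t *~ z t).
  by apply: IH (ltnW ir) _; exists c, z.
apply: (subgroup_sum zspan_sub (F := fun j => iotab C i j *~ d j)) => j jr.
exact: subgroup_mulrz (span_iotab j jr).
Qed.

Lemma iotab_qfree i : (i <= r)%N -> qfree (rk C) (iotab C i).
Proof.
elim: i => [_|i IH ir]; first by apply: zfree_qfree; case: setup => _ _ _ [_ + _] _.
apply: (qfree_triangular (b := iotab C i) (T := Qcoef C i)) => [m j mj|j jr||] //.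
- by rewrite /Qcoef ltn_eqF // ltnNge ltnW.
- rewrite /Qcoef eqxx mulf_neq0 ?invr_eq0 ?ee_neq0 //.
  by rewrite pnatr_eq0 -lt0n dd_gt0.
- exact: IH (ltnW ir).
Qed.

Lemma coordsE i x : (i <= r)%N -> GamIdx C i x ->
  x = \sum_(j < rk C) iotab C i j *~ coords C i x j.
Proof. by move=> ir /(GamIdx_zspan ir); apply: epsilon_spec. Qed.

Lemma coords_unique i x (c : nat -> int) j : (i <= r)%N -> GamIdx C i x ->
  x = \sum_(k < rk C) iotab C i k *~ c k -> (j < rk C)%N -> coords C i x j = c j.
Proof.
move=> ir x_in xE jr.
by apply: (zfree_inj (qfree_zfree (iotab_qfree ir))) => //; rewrite -coordsE.
Qed.

Lemma coordsD i x y j : (i <= r)%N -> GamIdx C i x -> GamIdx C i y -> (j < rk C)%N ->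
  coords C i (x + y) j = coords C i x j + coords C i y j.
Proof.
move=> ir x_in y_in; apply: (coords_unique (c := fun k => coords C i x k + coords C i y k)) => //.
  exact: (subgroupD (subgroup_GamIdx C i)).
under eq_bigr do rewrite mulrzDr.
by rewrite big_split -!coordsE.
Qed.

End Bases.

(** * Homogeneous elements of a graded algebra *)

Section GradedRing.
Variables (K : fieldType) (G : lmodType rat) (C : chain K G) (oC : group_order (le C)).
Local Notation V := (value_group oC).
Variable mu : {poly K} -> V.
Hypothesis muV : valuation mu.
Let muU := valuation_ultrametric muV.
Let muF := valuation_filtration muV.
Implicit Types (f g h p : {poly K}) (al be : V) (a b c : gr K G).
Local Notation "a ~ b" := (greq C mu a b) (at level 70).

Lemma greq_refl a : a ~ a.
Proof. by apply/greqP => be; apply: eqmod_refl. Qed.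

Lemma greq_sym a b : a ~ b -> b ~ a.
Proof. by move=> /greqP ab; apply/greqP => be; rewrite (eqmod_sym muU). Qed.

Lemma greq_trans b a c : a ~ b -> b ~ c -> a ~ c.
Proof.
move=> /greqP ab /greqP bc; apply/greqP => be.
exact: (eqmod_trans muU) (ab be) (bc be).
Qed.

Lemma greq_gadd a a' b b' : a ~ a' -> b ~ b' -> gadd a b ~ gadd a' b'.
Proof.
move=> /greqP aa' /greqP bb'; apply/greqP => be.
by rewrite !comp_cat; apply: eqmodD.
Qed.

Lemma greq_gmulr a b b' : valid C mu a -> b ~ b' -> gmul a b ~ gmul a b'.
Proof.
move=> va /greqP bb'; apply/greqP => be; rewrite !comp_gmul big_seq [X in eqmod _ _ _ X]big_seq.
apply: (eqmod_sum muU) => x xa; rewrite -[X in eqmod _ X](subrKC x.1) /eqmod -mulrBr.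
by apply: (filtMr muF); [apply: (allP va x xa) | apply: bb'].
Qed.

Lemma greq_gmulC a b : gmul a b ~ gmul b a.
Proof. by apply/greqP => be; rewrite comp_gmulC eqmod_refl. Qed.

Lemma greq_gmul a a' b b' : valid C mu a -> valid C mu b' ->
  a ~ a' -> b ~ b' -> gmul a b ~ gmul a' b'.
Proof.
move=> va vb' aa' bb'; apply: greq_trans (greq_gmulr va bb') _.
apply: greq_trans (greq_gmulC _ _) (greq_trans _ (greq_gmulC _ _)).
exact: greq_gmulr.
Qed.

Lemma greq_gmul_Hmu h a b : h != 0 -> gmul (Hmu mu h) a ~ gmul (Hmu mu h) b -> a ~ b.
Proof.
move=> h0 /greqP hab; apply/greqP => be; have := hab (mu h + be).
by rewrite !comp_gmul_Hmu (addrAC (mu h)) subrr add0r /eqmod -mulrBr (filt_mull muV).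
Qed.

Lemma valid_gmul a b : valid C mu a -> valid C mu b -> valid C mu (gmul a b).
Proof.
move=> va vb; apply/allP => z /allpairsP [[x y] /= [xa yb ->]] /=.
exact: (PgeM muF (allP va x xa) (allP vb y yb)).
Qed.

Definition homogeneous a al p := [/\ valid C mu a, Pge mu al p & a ~ [:: (al, p)]].

Lemma homogeneous_single al p : Pge mu al p -> homogeneous [:: (al, p)] al p.
Proof. by move=> al_p; split; [rewrite /valid /= andbT | | apply: greq_refl]. Qed.

Lemma homogeneous_Hmu f : f != 0 -> homogeneous (Hmu mu f) (mu f) f.
Proof. by move=> f0; rewrite /Hmu (negbTE f0); apply/homogeneous_single/Pge_value. Qed.

Lemma homogeneous0 al : homogeneous (gzero K G) al 0.
Proof.
split=> //; first exact: filt0.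
by apply/greqP => be; rewrite comp_single if_same /gcomp big_nil eqmod_refl.
Qed.

Lemma homogeneous1 : homogeneous (gone K G) 0 1.
Proof. by apply: homogeneous_single; rewrite -(value1 muV) Pge_value. Qed.

Lemma homogeneousD a b al p p' : homogeneous a al p -> homogeneous b al p' ->
  homogeneous (gadd a b) al (p + p').
Proof.
case=> va al_p ap [vb al_p' bp']; split; first by rewrite /valid all_cat; apply/andP.
  exact: (filtD muU).
apply: greq_trans (greq_gadd ap bp') _; apply/greqP => be.
by rewrite comp_cat !comp_single; case: eqP => _; rewrite ?addr0 eqmod_refl.
Qed.

Lemma homogeneousM a b al be p p' : homogeneous a al p -> homogeneous b be p' ->
  homogeneous (gmul a b) (al + be) (p * p').
Proof.
case=> va al_p ap [vb be_p' bp']; split; [exact: valid_gmul | exact: (PgeM muF) |].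
by apply: (greq_gmul va _ ap bp'); rewrite /valid /= andbT.
Qed.

Lemma homogeneousX a al p n : homogeneous a al p -> homogeneous (gexp a n) (al *+ n) (p ^+ n).
Proof.
move=> ap; elim: n => [|n IH] /=; first exact: homogeneous1.
by rewrite mulrS exprS; apply: homogeneousM.
Qed.

Lemma homogeneous_sum (I : eqType) (s : seq I) (a : I -> gr K G) al (p : I -> {poly K}) :
  (forall i, i \in s -> homogeneous (a i) al (p i)) ->
  homogeneous (gsum [seq a i | i <- s]) al (\sum_(i <- s) p i).
Proof.
elim: s => [|i s IH] ap /=; first by rewrite big_nil; apply: homogeneous0.
rewrite big_cons; apply: homogeneousD; first by apply: ap; rewrite mem_head.
by apply: IH => k ks; apply: ap; rewrite inE ks orbT.
Qed.

Lemma homogeneous_greq a b al p p' : homogeneous a al p -> homogeneous b al p' ->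
  eqmod mu al p p' -> a ~ b.
Proof.
case=> _ _ ap [_ _ bp'] pp'; apply: greq_trans ap (greq_trans _ (greq_sym bp')).
by apply/greqP => be; rewrite !comp_single; case: eqP => [->|_]; rewrite ?eqmod_refl.
Qed.

End GradedRing.

Section InitialFormsOfFractions.
Variables (K : fieldType) (G : lmodType rat) (C : chain K G) (oC : group_order (le C)).
Local Notation V := (value_group oC).
Variable mu : {poly K} -> V.
Hypothesis muV : valuation mu.
Let muU := valuation_ultrametric muV.
Let muF := valuation_filtration muV.
Implicit Types (f g h p : {poly K}) (al be : V) (q : {fraction {poly K}}).
Local Notation tof := (@FracField.tofrac {poly K}).

(* The fraction [q] has value [al] and the same initial form as [p]. *)
Definition frac_init q al p := [/\ p != 0, mu p = al &
  exists g h, [/\ h != 0, q = tof g / tof h & eqmod mu (al + mu h) (p * h) g]].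

Lemma frac_init_eqmod q al p g h : frac_init q al p -> h != 0 -> q = tof g / tof h ->
  eqmod mu (al + mu h) (p * h) g.
Proof.
case=> _ _ [g' [h' [h'0 qE' pg']]] h0 qE.
have gh' : g' * h = g * h'.
  apply/eqP; rewrite -tofrac_eq !tofracM; apply/eqP; apply: (canRL (divfK _)).
    by rewrite tofrac_eq0.
  by rewrite mulrAC -qE' qE divfK ?tofrac_eq0.
rewrite /eqmod -(filt_mull muV _ _ _ h'0).
have -> : h' * (p * h - g) = (p * h' - g') * h by rewrite mulrBr [h' * g]mulrC -gh'; ring.
by rewrite addrCA addrA; apply: (filtM muF) pg' (Pge_value mu h).
Qed.

Lemma frac_init_num q al p g h : frac_init q al p -> h != 0 -> q = tof g / tof h ->
  g != 0 /\ mu g = al + mu h.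
Proof.
move=> qp h0 qE; have [p0 vp _] := qp; rewrite -vp -(valueM muV) //.
apply: (eqmod_value muU); first exact: mulf_neq0.
by rewrite (valueM muV) // vp; apply: frac_init_eqmod qp h0 qE.
Qed.

Lemma frac_init_neq0 q al p : frac_init q al p -> q != 0.
Proof.
move=> qp; have [_ _ [g [h [h0 qE _]]]] := qp; have [g0 _] := frac_init_num qp h0 qE.
by rewrite qE mulf_neq0 ?invr_eq0 ?tofrac_eq0.
Qed.

Lemma frac_init_unique q al p p' : frac_init q al p -> frac_init q al p' -> eqmod mu al p p'.
Proof.
move=> qp qp'; have [_ _ [g [h [h0 qE pg]]]] := qp.
have pp'h : eqmod mu (al + mu h) (p * h) (p' * h).
  by apply: (eqmod_trans muU) pg _; rewrite (eqmod_sym muU); apply: frac_init_eqmod qp' h0 qE.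
by rewrite /eqmod -(filt_mull muV _ _ _ h0) mulrBr ![h * _]mulrC addrC.
Qed.

Lemma frac_init_tofrac f : f != 0 -> frac_init (tof f) (mu f) f.
Proof.
by move=> f0; split=> //; exists f, 1; rewrite oner_neq0 tofrac1 divr1 mulr1 eqmod_refl.
Qed.

Lemma frac_init1 : frac_init 1 0 1.
Proof. by have := frac_init_tofrac (oner_neq0 _); rewrite tofrac1 (value1 muV). Qed.

Lemma frac_initM q q' al be p p' : frac_init q al p -> frac_init q' be p' ->
  frac_init (q * q') (al + be) (p * p').
Proof.
move=> qp qp'; have [p0 vp [g [h [h0 qE pg]]]] := qp.
have [p'0 vp' [g' [h' [h'0 qE' pg']]]] := qp'.
split; [exact: mulf_neq0 | by rewrite (valueM muV) // vp vp' |].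
exists (g * g'), (h * h'); split; first exact: mulf_neq0.
  by rewrite qE qE' !tofracM mulf_div.
rewrite (valueM muV) // addrACA mulrACA; apply: (eqmodM muF) => //.
  by have [_ <-] := frac_init_num qp h0 qE; apply: Pge_value.
by rewrite -vp' -(valueM muV) // Pge_value.
Qed.

Lemma frac_initX q al p n : frac_init q al p -> frac_init (q ^+ n) (al *+ n) (p ^+ n).
Proof.
move=> qp; elim: n => [|n IH]; first exact: frac_init1.
by rewrite mulrS !exprS; apply: frac_initM.
Qed.

Lemma frac_initV q al p p' : frac_init q al p -> eqmod mu 0 (p * p') 1 ->
  frac_init q^-1 (- al) p'.
Proof.
move=> qp pp'; have [_ vp [g [h [h0 qE pg]]]] := qp.
have [_ p'0 vp'] := init_unit_inverse muV pp'; have [g0 vg] := frac_init_num qp h0 qE.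
split=> //; first by rewrite vp' vp.
exists h, g; split=> //; first by rewrite qE invf_div.
rewrite vg addKr; have p'g : eqmod mu (mu h) (p' * g) (p' * (p * h)).
  rewrite -[X in eqmod _ X](addKr al) -vp -vp' vp.
  rewrite (eqmod_sym muU) /eqmod -mulrBr.
  by apply: (filtMr muF) (Pge_value mu p') pg.
apply: (eqmod_trans muU) p'g _; rewrite mulrA [p' * p]mulrC -[X in eqmod _ X]add0r.
by rewrite -[X in eqmod _ _ _ X]mul1r /eqmod -mulrBl; apply: (filtM muF) pp' (Pge_value mu h).
Qed.

Lemma homogeneous_Hfrac q al p : frac_init q al p -> homogeneous mu (Hfrac C mu q) al p.
Proof.
move=> qp; have [_ vp _] := qp; have al_p : Pge mu al p by rewrite -vp Pge_value.
have p_al := homogeneous_single al_p.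
have quotient g h : h != 0 -> q = tof g / tof h ->
    greq C mu (gmul [:: (al, p)] (Hmu mu h)) (Hmu mu g).
  move=> h0 qE; have [g0 vg] := frac_init_num qp h0 qE.
  have := homogeneous_Hmu mu g0; rewrite vg => Hg.
  exact: (homogeneous_greq muV (homogeneousM muV p_al (homogeneous_Hmu mu h0)) Hg
    (frac_init_eqmod qp h0 qE)).
have ex : exists z, valid C mu z /\ exists g h : {poly K},
    h != 0 /\ q = tof g / tof h /\ greq C mu (gmul z (Hmu mu h)) (Hmu mu g).
  have [_ _ [g [h [h0 qE _]]]] := qp; exists [:: (al, p)]; split; first by case: p_al.
  by exists g, h; do 2!split=> //; apply: quotient.
have [vz [g [h [h0 [qE zh]]]]] := epsilon_spec (inhabits (gzero K G)) _ ex.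
split=> //; apply: (greq_gmul_Hmu muV h0).
apply: (greq_trans muV) (greq_gmulC _ _ _) (greq_trans muV _ (greq_gmulC _ _ _)).
exact: (greq_trans muV) zh (greq_sym muV (quotient g h h0 qE)).
Qed.

Definition unit_frac q al := exists2 p, frac_init q al p & init_unit mu p.

Lemma unit_frac_tofrac f : init_unit mu f -> unit_frac (tof f) (mu f).
Proof. by move=> f_unit; exists f => //; apply/frac_init_tofrac/(init_unit_neq0 muV). Qed.

Lemma unit_frac1 : unit_frac 1 0.
Proof. by exists 1; [apply: frac_init1 | apply: init_unit1]. Qed.

Lemma unit_fracM q q' al be : unit_frac q al -> unit_frac q' be -> unit_frac (q * q') (al + be).
Proof.
by case=> p qp p_unit [p' qp' p'_unit]; exists (p * p'); [apply: frac_initM | apply: init_unitM].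
Qed.

Lemma unit_fracV q al : unit_frac q al -> unit_frac q^-1 (- al).
Proof.
case=> p qp [p' pp']; exists p'; first exact: frac_initV qp pp'.
by exists p; rewrite mulrC.
Qed.

Lemma unit_frac_exprz q al (n : int) : unit_frac q al -> unit_frac (q ^ n) (al *~ n).
Proof.
move=> q_unit; have unit_fracX m : unit_frac (q ^+ m) (al *+ m).
  elim: m => [|m IH]; first exact: unit_frac1.
  by rewrite mulrS exprS; apply: unit_fracM.
by case: n => m; [apply: unit_fracX | apply: unit_fracV (unit_fracX m.+1)].
Qed.

Lemma unit_frac_prod n (q : nat -> {fraction {poly K}}) (al : nat -> V) :
  (forall j, (j < n)%N -> unit_frac (q j) (al j)) ->
  unit_frac (\prod_(j < n) q j) (\sum_(j < n) al j).
Proof.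
elim: n => [|n IH] q_unit; first by rewrite !big_ord0; apply: unit_frac1.
rewrite !big_ord_recr /=; apply: unit_fracM; last exact: q_unit.
by apply: IH => j jn; apply/q_unit/ltnW.
Qed.

End InitialFormsOfFractions.

Section PiFractions.
Variables (K : fieldType) (G : lmodType rat) (C : chain K G) (r : nat).
Hypothesis setup : MacLane_setup C r.
Let muV := muc_valuation setup (leqnn r).
Local Notation V := (value_group (setup_order setup)).
Local Notation mu := (muc C r.+1 : {poly K} -> V).

Lemma unit_frac_piF i j : (i <= r)%N -> (j < rk C)%N -> unit_frac mu (piF C i j) (iotab C i j).
Proof.
elim: i j => [|i IH] j ir jr /=.
  have [_ _ _ _ [_ _ _ /(_ j jr) [pi0 <-]]] := setup.
  rewrite -(muc_polyC setup (leqnn r.+1) pi0).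
  exact: (unit_frac_tofrac muV (init_unit_polyC setup _ pi0)).
rewrite -/(iotab C i.+1 j) (iotabS_value setup ir jr).
apply: (unit_fracM muV); last exact: (unit_frac_exprz muV _ (IH j (ltnW ir) jr)).
apply: (unit_fracM muV).
  have [phi_unit <-] := init_unit_phi setup (introT andP (conj ir (leqnn r))).
  exact: (unit_frac_exprz muV _ (unit_frac_tofrac muV phi_unit)).
pose n t : int := - (ll C i j * (eprime C i j %/ ee C i t)%:Z * hh C i t).
apply: (unit_frac_prod muV (q := fun t => piF C i t ^ n t)
  (al := fun t => iotab C i t *~ n t)) => t tj.
exact: (unit_frac_exprz muV _ (IH t (ltnW ir) (ltn_trans tj jr))).
Qed.

Lemma unit_frac_pipow x : GamIdx C r x -> unit_frac mu (pipow C r x) x.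
Proof.
move=> x_in; rewrite {2}(coordsE setup (leqnn r) x_in).
apply: (unit_frac_prod muV (q := fun j => piF C r j ^ coords C r x j)
  (al := fun j => iotab C r j *~ coords C r x j)) => j jr.
exact: (unit_frac_exprz muV _ (unit_frac_piF (leqnn r) jr)).
Qed.

Lemma pipowD x y : GamIdx C r x -> GamIdx C r y ->
  pipow C r (x + y) = pipow C r x * pipow C r y.
Proof.
move=> x_in y_in; rewrite /pipow -big_split; apply: eq_bigr => j _ /=.
have [p /(frac_init_neq0 muV) pi_neq0 _] := unit_frac_piF (leqnn r) (ltn_ord j).
by rewrite (coordsD setup) // expfzDr.
Qed.

Lemma pipow0 : pipow C r 0 = 1.
Proof.
have zero_in := (subgroup_GamIdx C r).1.
have [p /(frac_init_neq0 muV) neq0 _] := unit_frac_pipow zero_in.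
by apply: (mulfI neq0); rewrite -pipowD // addr0 mulr1.
Qed.

Lemma pipowMn x n : GamIdx C r x -> pipow C r (x *+ n) = pipow C r x ^+ n.
Proof.
move=> x_in; elim: n => [|n IH]; first by rewrite mulr0n pipow0.
by rewrite mulrS exprS pipowD ?IH // pmulrn; apply: (subgroup_mulrz (subgroup_GamIdx C r)).
Qed.

End PiFractions.

(** * The Newton polygon *)

Section Convexity.
Variables (G : lmodType rat) (R : rel G) (oR : group_order R).
Local Notation V := (value_group oR).
Variable pts : seq (nat * G).
Implicit Types (t : rat) (w : G) (z : nat * G).

Lemma conv_pt_vertex z : z \in pts -> conv_pt pts z.1%:R z.2.
Proof.
move=> z_in; have iz : (index z pts < size pts)%N by rewrite index_mem.
exists (fun k => (k == index z pts)%:R); split; first by move=> k; rewrite ler0n.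
have nz (k : 'I_(size pts)) : k != Ordinal iz -> (val k == index z pts) = false.
  by rewrite -val_eqE => /negbTE.
by split; [|split]; rewrite (bigD1 (Ordinal iz)) //= eqxx ?mul1r ?scale1r ?nth_index //
  big1 ?addr0 // => k /nz /= ->; rewrite ?mul0r ?scale0r.
Qed.

Lemma conv_pt_mix (l t t' : rat) w w' : 0 <= l <= 1 -> conv_pt pts t w -> conv_pt pts t' w' ->
  conv_pt pts (l * t + (1 - l) * t') (l *: w + (1 - l) *: w').
Proof.
case/andP=> l0 l1 [c [c_ge0 [c_sum [-> ->]]]] [d [d_ge0 [d_sum [-> ->]]]].
exists (fun k => l * c k + (1 - l) * d k); split; [|split; [|split]].
- by move=> k; rewrite addr_ge0 ?mulr_ge0 // subr_ge0.
- by rewrite big_split -!mulr_sumr c_sum d_sum /=; ring.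
- by rewrite !mulr_sumr -big_split; apply: eq_bigr => k _ /=; ring.
- rewrite !scaler_sumr -big_split; apply: eq_bigr => k _ /=.
  by rewrite !scalerA -scalerDl.
Qed.

Variables (gm M : G).

Lemma conv_pt_segment t0 t1 t w0 w1 : conv_pt pts t0 w0 -> conv_pt pts t1 w1 ->
  w0 + t0 *: gm = M -> w1 + t1 *: gm = M -> t0 <= t <= t1 -> conv_pt pts t (M - t *: gm).
Proof.
move=> pt0 pt1 line0 line1 /andP[t0t tt1].
have -> : M - t *: gm = w0 + (t0 - t) *: gm by rewrite scalerBl addrA line0.
case: (ltgtP t0 t1) (le_trans t0t tt1) => [lt01 _|//|e01 _]; last first.
  have et : t0 = t by apply: le_anti; rewrite t0t e01.
  by rewrite -et subrr scale0r addr0.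
have t01 : t1 - t0 != 0 by rewrite subr_eq0 gt_eqF.
pose l := (t1 - t) / (t1 - t0).
have l_bounds : 0 <= l <= 1.
  rewrite divr_ge0 ?subr_ge0 ?(ltW lt01) //=.
  by rewrite ler_pdivrMr ?subr_gt0 // mul1r lerB.
have := conv_pt_mix l_bounds pt0 pt1.
have -> : l * t0 + (1 - l) * t1 = t by rewrite /l; field.
suff -> : l *: w0 + (1 - l) *: w1 = w0 + (t0 - t) *: gm by [].
have -> : w1 = w0 + (t0 - t1) *: gm.
  by rewrite scalerBl addrA line0 -line1 addrK.
rewrite scalerDr addrA -scalerDl subrKC scale1r scalerA; congr (_ + _ *: _).
by rewrite /l; field.
Qed.

Local Notation vertex k := (nth (0%N, 0 : G) pts k).

Definition elevation z := z.2 + z.1%:R *: gm - M.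

Hypothesis elevation_ge0 : forall z, z \in pts -> 0 <= elevation z :> V.

Lemma conv_pt_elevation t w : conv_pt pts t w -> exists c : 'I_(size pts) -> rat,
  [/\ forall k, 0 <= c k, \sum_k c k = 1, t = \sum_k c k * (vertex k).1%:R &
      w + t *: gm - M = \sum_k c k *: elevation (vertex k)].
Proof.
case=> c [c_ge0 [c_sum [et ew]]]; exists (fun k => c k); split=> //.
have -> : M = \sum_(k < size pts) c k *: M by rewrite -scaler_suml c_sum scale1r.
rewrite et ew scaler_suml -big_split -sumrB /=; apply: eq_bigr => k _.
by rewrite /elevation scalerBr scalerDr scalerA.
Qed.

Lemma conv_pt_ge t w : conv_pt pts t w -> M <= w + t *: gm :> V.
Proof.
case/conv_pt_elevation => c [c_ge0 _ _ e]; rewrite -subg_ge0 [X in _ <= X]e.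
by apply: (sumg_ge0 (oR := oR)) => k _; apply: scaleg_ge0 (c_ge0 k) (elevation_ge0 (mem_nth _ _)).
Qed.

Lemma conv_pt_bounds (b b' : nat) t w :
  (forall z, z \in pts -> elevation z = 0 -> (b <= z.1 <= b')%N) ->
  conv_pt pts t w -> w + t *: gm = M -> b%:R <= t <= b'%:R.
Proof.
move=> bounds /conv_pt_elevation [c [c_ge0 c_sum et e]] eM; move: e; rewrite eM subrr => /esym e.
have terms_ge0 k : 0 <= c k *: elevation (vertex k) :> V.
  exact: scaleg_ge0 (c_ge0 k) (elevation_ge0 (mem_nth _ _)).
have in_bounds k : c k != 0 -> (b <= (vertex k).1 <= b')%N.
  move=> ck; apply: bounds; first exact: mem_nth.
  have/eqP := sumg_eq0 terms_ge0 e k.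
  by rewrite scaler_eq0 (negbTE ck) => /eqP.
have average (q : rat) : q = \sum_k c k * q by rewrite -mulr_suml c_sum mul1r.
rewrite et [b%:R]average [b'%:R]average; apply/andP; split;
  apply: ler_sum => k _; have [->|/in_bounds/andP[lb ub]] := eqVneq (c k) 0;
  by rewrite ?mul0r // ler_wpM2l ?ler_nat.
Qed.

End Convexity.

Section Newton.
Variables (K : fieldType) (G : lmodType rat) (C : chain K G) (r : nat).
Hypothesis setup : MacLane_setup C r.
Let aug := muc_augmentable setup (leqnn r).
Local Notation V := (value_group (setup_order setup)).
Variable f : {poly K}.
Hypothesis f0 : f != 0.
Local Notation a s := (coefs (phi C r) f s).
Local Notation M := (muc C r.+1 f).
Local Notation on_side := (attained (muc C r : {poly K} -> V) (phi C r) (gam C r) f).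
Implicit Types (s b : nat) (t : rat) (w : G).

Lemma mem_npts z : reflect (exists2 s, a s != 0 & z = (s, muc C r (a s))) (z \in npts C r f).
Proof.
apply: (iffP mapP) => [[s]|[s as0 ->]]; first by rewrite mem_filter => /andP[as0 _] ->; exists s.
by exists s; rewrite // mem_filter as0 mem_iota size_phiexp; apply: coefs_size_gt as0.
Qed.

Lemma on_side_value s : on_side s -> muc C r (a s) + s%:R *: gam C r = M.
Proof. by rewrite scaler_nat; apply: attained_value. Qed.

Lemma elevation_npts_ge0 z : z \in npts C r f -> 0 <= elevation (gam C r) M z :> V.
Proof.
case/mem_npts => s as0 ->; rewrite /elevation /= scaler_nat subg_ge0.
exact: (augment_le (muc C r : _ -> V) (gam C r) as0).
Qed.

Lemma elevation_npts_eq0 z : z \in npts C r f -> elevation (gam C r) M z = 0 -> on_side z.1.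
Proof.
case/mem_npts => s as0 -> /eqP; rewrite /elevation subr_eq0 /= scaler_nat => e.
by rewrite /attained as0.
Qed.

Lemma coefs_conv_pt s : a s != 0 -> conv_pt (npts C r f) s%:R (muc C r (a s)).
Proof. by move=> as0; apply: (@conv_pt_vertex _ _ (s, _)); apply/mem_npts; exists s. Qed.

Lemma on_side_inS s : on_side s -> inS C r f s%:R (muc C r (a s)).
Proof.
move=> on_s; have /andP[as0 _] := on_s; split=> [|t w [tw _]]; first split.
- exact: coefs_conv_pt.
- move=> w /(conv_pt_ge elevation_npts_ge0).
  by rewrite -(on_side_value on_s) legD2r.
- by rewrite on_side_value //; apply: (conv_pt_ge elevation_npts_ge0 tw).
Qed.

Lemma inS_value t w : inS C r f t w -> w + t *: gam C r = M.
Proof.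
case=> [[tw _] w_min]; have [s on_s] := attained_ex aug f0.
apply: (@le_anti _ V); rewrite [X in _ && X](conv_pt_ge elevation_npts_ge0 tw) andbT.
by have := w_min _ _ (on_side_inS on_s).1; rewrite on_side_value.
Qed.

Lemma inS_bounds b (b' : nat) t w : (forall s, on_side s -> (b <= s <= b')%N) ->
  inS C r f t w -> b%:R <= t <= b'%:R.
Proof.
move=> bounds tw; have [[tw_conv _] _] := tw.
apply: (conv_pt_bounds elevation_npts_ge0 _ tw_conv (inS_value tw)) => z z_in z0.
exact/bounds/elevation_npts_eq0.
Qed.

Lemma epsilon_side_end (ord : rel rat) s0 : antisymmetric ord -> on_side s0 ->
  (forall t w, inS C r f t w -> ord s0%:R t) ->
  epsilon (inhabits 0%N) (fun s : nat =>
    (exists u, inS C r f s%:R u) /\ forall t w, inS C r f t w -> ord s%:R t) = s0.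
Proof.
move=> ord_anti on_s0 s0_ext.
have : exists s : nat, (exists u, inS C r f s%:R u) /\ forall t w, inS C r f t w -> ord s%:R t.
  by exists s0; split=> //; eexists; apply: on_side_inS on_s0.
move=> /(epsilon_spec (inhabits 0%N)); set s := epsilon _ _ => -[[u su] s_ext].
apply/eqP; rewrite -(eqr_nat rat); apply/eqP/ord_anti.
by rewrite (s0_ext _ _ su) (s_ext _ _ (on_side_inS on_s0)).
Qed.

Lemma sL_minP : on_side (sL C r f) /\ forall s, on_side s -> (sL C r f <= s)%N.
Proof.
have [s0 on_s0 min_s0] := first_attained_ex aug f0.
have bounds s : on_side s -> (s0 <= s <= size f)%N.
  by move=> on_s; rewrite min_s0 // ltnW // (attained_size on_s).
suff -> : sL C r f = s0 by [].
apply: (epsilon_side_end (ord := <=%R)) on_s0 _; first exact: le_anti.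
by move=> t w /(inS_bounds bounds)/andP[].
Qed.

Lemma sR_maxP : on_side (sR C r f) /\ forall s, on_side s -> (s <= sR C r f)%N.
Proof.
have le_size s : on_side s -> (s <= size f)%N by move=> on_s; rewrite ltnW // (attained_size on_s).
have [s1 on_s1 max_s1] := ex_maxnP (attained_ex aug f0) le_size.
suff -> : sR C r f = s1 by [].
apply: (epsilon_side_end (ord := >=%R)) on_s1 _; first exact: ge_anti.
by move=> t w /(inS_bounds (b := 0) max_s1)/andP[].
Qed.

Lemma uLE : uL C r f = muc C r (a (sL C r f)).
Proof.
have [on_left _] := sL_minP; have : exists u, inS C r f (sL C r f)%:R u.
  by eexists; apply: on_side_inS on_left.
move=> /(epsilon_spec (inhabits 0)) /inS_value.
by rewrite -/(uL C r f) -(on_side_value on_left) => /addIr.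
Qed.

(* Between its end points the side lies in the convex hull, so that N_r(f) is
   not above it. *)
Lemma onN_on_side s : (sL C r f <= s <= sR C r f)%N -> a s != 0 ->
  onN C r f s%:R (muc C r (a s)) <-> on_side s.
Proof.
move=> sLR as0; split=> [[_ w_min]|]; last by case/on_side_inS.
have [[on_left _] [on_right _]] := (sL_minP, sR_maxP).
have [[[left_pt _] _] [[right_pt _] _]] := (on_side_inS on_left, on_side_inS on_right).
have seg : conv_pt (npts C r f) s%:R (M - s%:R *: gam C r).
  by apply: (conv_pt_segment left_pt right_pt); rewrite ?on_side_value // !ler_nat.
rewrite /attained as0; apply/eqP/(@le_anti _ V)/andP; split.
  by rewrite -scaler_nat -legBrDr; apply: w_min seg.
exact: (augment_le (muc C r : _ -> V) (gam C r) as0).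
Qed.

End Newton.

(** * The residual polynomial *)

Section Residual.
Variables (K : fieldType) (G : lmodType rat) (C : chain K G) (r : nat).
Hypothesis setup : MacLane_setup C r.
Let aug := muc_augmentable setup (leqnn r).
Let p_gt1 := augmentable_size aug.
Let muV := muc_valuation setup (leqnn r).
Let muU := valuation_ultrametric muV.
Let muF := valuation_filtration muV.
Local Notation V := (value_group (setup_order setup)).
Local Notation p := (phi C r).
Local Notation mu := (muc C r.+1 : {poly K} -> V).
Local Notation nu := (muc C r).
Local Notation e := (eidx C r).
Let GamIdx_sub := subgroup_GamIdx C r.
Let GamMu_sub := subgroup_GamMu setup (leqnSn r).

Definition pi_poly (x : G) : {poly K} :=
  epsilon (inhabits 0) (frac_init mu (pipow C r x) x).

Lemma pi_polyP x : GamIdx C r x -> frac_init mu (pipow C r x) x (pi_poly x).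
Proof.
by move=> /(unit_frac_pipow setup) [q qx _]; apply: epsilon_spec; exists q.
Qed.

Lemma homogeneous_pr x : GamIdx C r x -> homogeneous mu (pr C r x) x (pi_poly x).
Proof. by move=> x_in; apply: homogeneous_Hfrac (pi_polyP x_in). Qed.

Definition y_poly : {poly K} := p ^+ e * pi_poly (- hbig C r).

Lemma GamIdx_hbigN : GamIdx C r (- hbig C r).
Proof. exact: (subgroupN GamIdx_sub (GamIdx_hbig setup (leqnn r))). Qed.

Lemma frac_init_phi : frac_init mu (FracField.tofrac p) (gam C r) p.
Proof.
by have := frac_init_tofrac mu (phi_neq0 setup (leqnn r)); rewrite (muc_phi setup).
Qed.

Lemma homogeneous_yr : homogeneous mu (yr C r) 0 y_poly.
Proof.
apply: (homogeneous_Hfrac muV).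
have := frac_initM muV (frac_initX muV e frac_init_phi) (pi_polyP GamIdx_hbigN).
by rewrite -/(hbig C r) subrr.
Qed.

Lemma homogeneous_xrX n : homogeneous mu (gexp (xr C r) n) (gam C r *+ n) (p ^+ n).
Proof.
apply: (homogeneousX muV); rewrite -(muc_phi setup (leqnn r)).
exact: homogeneous_Hmu (phi_neq0 setup (leqnn r)).
Qed.

Lemma pi_poly_prod_eqmod1 u x j : GamIdx C r u -> GamIdx C r x ->
  u - x - hbig C r *+ j = 0 ->
  eqmod mu 0 (pi_poly u * pi_poly (- x) * pi_poly (- hbig C r) ^+ j) 1.
Proof.
move=> u_in x_in rel0; have Nx_in := subgroupN GamIdx_sub x_in.
have jNh_in : GamIdx C r (- hbig C r *+ j).
  by rewrite pmulrn; apply: (subgroup_mulrz GamIdx_sub); apply: GamIdx_hbigN.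
have pi1 : pipow C r u * pipow C r (- x) * pipow C r (- hbig C r) ^+ j = 1.
  rewrite -(pipowMn setup j GamIdx_hbigN) -(pipowD setup u_in Nx_in).
  by rewrite -(pipowD setup (GamIdx_sub.2 _ _ u_in x_in) jNh_in) mulNrn rel0 (pipow0 setup).
have := frac_initM muV (frac_initM muV (pi_polyP u_in) (pi_polyP Nx_in))
  (frac_initX muV j (pi_polyP GamIdx_hbigN)).
rewrite pi1 mulNrn rel0 => one; exact: (frac_init_unique muV) one (frac_init1 muV).
Qed.

Variable f : {poly K}.
Hypotheses (f0 : f != 0) (f_att : GamIdx C r.+1 (muc C r.+1 f)).
Local Notation a s := (coefs p f s).
Local Notation on_side := (attained (nu : {poly K} -> V) p (gam C r) f).
Local Notation s0 := (sL C r f).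
Local Notation d := ((sR C r f - sL C r f) %/ e)%N.

Lemma GamMu_coef s : a s != 0 -> GamMu C r (nu (a s)).
Proof. by move=> as0; apply: (GamMu_muc setup (leqnn r) as0 (size_coefs p_gt1 f s)). Qed.

Lemma GamIdx_uL : GamIdx C r (uL C r f).
Proof.
have [on_left _] := sL_minP setup f0; have /andP[aL0 _] := on_left.
rewrite (uLE setup f0); have [c [z fE]] := f_att.
set g := \sum_(j < rk C) iota0 C j *~ c j + \sum_(t < r) gam C t *~ z t.
have g_in : GamIdx C r g by exists c, z.
have uE : nu (a s0) = g + gam C r *~ (z r - s0%:Z).
  apply: (addIr (gam C r *+ s0)); rewrite (etrans (attained_value on_left) fE).
  rewrite big_ord_recr /= mulrzBr.
  by rewrite -!addrA addNr addr0.
rewrite uE; apply: (subgroupD GamIdx_sub) => //; apply: (GamIdx_gam_mulrz setup) => //.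
have -> : gam C r *~ (z r - s0%:Z) = nu (a s0) - g by rewrite uE [RHS]addrC addKr.
apply: GamMu_sub.2; first exact: GamMu_coef.
exact: (GamIdx_GamMu setup) (leqnSn r) g_in.
Qed.

Lemma on_side_value_sub s s' : on_side s -> on_side s' -> (s <= s')%N ->
  nu (a s) - nu (a s') = gam C r *+ (s' - s).
Proof.
move=> on_s on_s' ss'; apply: (addIr (nu (a s') + gam C r *+ s)).
by rewrite addrA subrK addrCA -mulrnDr subnK // (attained_value on_s) (attained_value on_s').
Qed.

Lemma on_side_index s : on_side s -> exists2 j, (j <= d)%N & s = (s0 + j * e)%N.
Proof.
move=> on_s; have [[on_left minL] [_ maxR]] := (sL_minP setup f0, sR_maxP setup f0).
have : (e %| (s - s0)%N%:Z)%Z.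
  apply: (eidx_dvd setup) => //; rewrite -pmulrn -(on_side_value_sub on_left on_s) ?minL //.
  by apply: GamMu_sub.2; apply: GamMu_coef; [case/andP: on_left | case/andP: on_s].
rewrite dvdzE /= => /dvdnP[j ej]; exists j; last by rewrite -ej subnKC // minL.
by rewrite leq_divRL ?(eidx_gt0 setup) // -ej leq_sub2r // maxR.
Qed.

Lemma side_index_bounds j : (j <= d)%N -> (s0 <= s0 + j * e <= sR C r f)%N.
Proof.
move=> jd; rewrite leq_addr /=.
have [[on_left _] [_ maxR]] := (sL_minP setup f0, sR_maxP setup f0).
rewrite -(subnKC (maxR _ on_left)) leq_add2l (leq_trans _ (leq_divM _ e)) //.
by rewrite leq_mul2r jd orbT.
Qed.

Definition res_coef j : {poly K} :=
  let s := (s0 + j * e)%N in if on_side s then pi_poly (- nu (a s)) * a s else 0.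

Lemma on_side_coef_value j : on_side (s0 + j * e) ->
  nu (a (s0 + j * e)) = uL C r f - hbig C r *+ j.
Proof.
move=> on_s; have [on_left _] := sL_minP setup f0.
have := on_side_value_sub on_left on_s (leq_addr _ _).
rewrite addKn mulnC mulrnA -/(hbig C r) -(uLE setup f0) => <-.
by rewrite opprB addrC subrK.
Qed.

Lemma GamIdx_side_coef j : on_side (s0 + j * e) -> GamIdx C r (nu (a (s0 + j * e))).
Proof.
move=> /on_side_coef_value ->; apply: GamIdx_sub.2; first exact: GamIdx_uL.
rewrite pmulrn; apply: (subgroup_mulrz GamIdx_sub); exact: (GamIdx_hbig setup).
Qed.

Lemma homogeneous_Rcoef j : (j <= d)%N -> homogeneous mu (Rcoef C r f j) 0 (res_coef j).
Proof.
move=> jd; rewrite /Rcoef /res_coef; set s := (s0 + j * e)%N.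
have on_side_iff := onN_on_side setup f0 (side_index_bounds jd).
case: excluded_middle_informative => [[as0 as_N]|not_N].
  have on_s := (on_side_iff as0).1 as_N; rewrite ifT //.
  have va : mu (a s) = nu (a s) := muc_small setup (leqnn r) as0 (size_coefs p_gt1 f s).
  have := homogeneous_Hmu mu as0; rewrite va => Ha.
  rewrite -(addNr (nu (a s))); apply: (homogeneousM muV) Ha.
  by apply: homogeneous_pr; apply: (subgroupN GamIdx_sub); apply: GamIdx_side_coef.
rewrite ifN; first exact: homogeneous0.
apply/negP => on_s; apply: not_N; have /andP[as0 _] := on_s.
by split=> //; apply/on_side_iff.
Qed.

Lemma homogeneous_Reval :
  homogeneous mu (Reval (Rres C r f) (yr C r)) 0 (\sum_(j <- iota 0 d.+1) res_coef j * y_poly ^+ j).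
Proof.
rewrite /Reval size_map size_iota; apply: (homogeneous_sum muV) => j; rewrite mem_iota => jd.
rewrite (nth_map 0%N) ?size_iota // nth_iota // add0n.
have := homogeneousX muV j homogeneous_yr; rewrite mul0rn => Hy.
by rewrite -[0]addr0; apply: (homogeneousM muV (homogeneous_Rcoef jd) Hy).
Qed.

Lemma residual_term j : on_side (s0 + j * e) ->
  eqmod mu (mu f) (a (s0 + j * e) * p ^+ (s0 + j * e))
    (p ^+ s0 * pi_poly (uL C r f) * (res_coef j * y_poly ^+ j)).
Proof.
move=> on_s; have /andP[as0 _] := on_s; rewrite /res_coef on_s.
set s := (s0 + j * e)%N in on_s as0 *.
set Pu := pi_poly (uL C r f); set Pa := pi_poly _; set Ph := pi_poly (- hbig C r).
have rel : eqmod mu 0 (Pu * Pa * Ph ^+ j) 1.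
  apply: pi_poly_prod_eqmod1; [exact: GamIdx_uL | exact: GamIdx_side_coef |].
  by rewrite on_side_coef_value // subKr subrr.
have va : mu (a s) = nu (a s) := muc_small setup (leqnn r) as0 (size_coefs p_gt1 f s).
have vM : mu (a s * p ^+ s) = mu f.
  rewrite (valueM muV) ?expf_neq0 ?(phi_neq0 setup) // (valueX muV) ?(phi_neq0 setup) //.
  by rewrite (muc_phi setup) // va (attained_value on_s).
have -> : p ^+ s0 * Pu * (Pa * a s * y_poly ^+ j) = a s * p ^+ s * (Pu * Pa * Ph ^+ j).
  rewrite /y_poly -/Ph exprMn -exprM [(e * j)%N]mulnC /s exprD.
  by move: (a _) (p ^+ s0) (p ^+ (j * e)) (Ph ^+ j) => A X Y Z; ring.
rewrite (eqmod_sym muU) -[X in eqmod _ _ _ X]mulr1 -vM -[X in eqmod _ X]addr0.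
by rewrite /eqmod -mulrBr; apply: (filtMr muF) (Pge_value mu _) rel.
Qed.

Lemma residual_eqmod : eqmod mu (mu f) f
  (p ^+ s0 * pi_poly (uL C r f) * \sum_(j <- iota 0 d.+1) res_coef j * y_poly ^+ j).
Proof.
pose l := [seq (s0 + j * e)%N | j <- iota 0 d.+1].
have l_uniq : uniq l.
  rewrite map_inj_uniq ?iota_uniq // => j k /addnI/eqP.
  by rewrite eqn_pmul2r ?(eidx_gt0 setup) // => /eqP.
have side_l s : on_side s -> s \in l.
  by case/on_side_index => j jd ->; apply/mapP; exists j; rewrite ?mem_iota.
apply: (eqmod_trans muU) (augment_eqmod_sum aug l_uniq side_l) _.
rewrite big_map big_mkcond mulr_sumr; apply: (eqmod_sum muU) => j _.
case: ifPn => [|not_side]; first exact: residual_term.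
by rewrite /res_coef (negbTE not_side) mul0r mulr0 eqmod_refl.
Qed.

End Residual.

Theorem mainTheorem9 (K : fieldType) (G : lmodType rat) (C : chain K G) (r : nat) :
  MacLane_setup C r ->
  forall f : {poly K}, f != 0 ->
    (* f is mu-attainable: mu(f) in Gamma_r *)
    GamIdx C r.+1 (muc C r.+1 f) ->
    (* u_r(f) in Gamma_{r-1} *)
    GamIdx C r (uL C r f) /\
    (* H_mu(f) = x_r^{s_r(f)} p_r^{u_r(f)} R_r(f)(y_r) in G_mu *)
    greq C (muc C r.+1) (Hmu (muc C r.+1) f)
      (gmul (gmul (gexp (xr C r) (sL C r f)) (pr C r (uL C r f)))
            (Reval (Rres C r f) (yr C r))).
Proof.
move=> setup f f0 f_att; have uL_in := GamIdx_uL setup f0 f_att; split=> //.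
have muV := muc_valuation setup (leqnn r); have [on_left _] := sL_minP setup f0.
have monomial := homogeneousM muV (homogeneous_xrX setup (sL C r f)) (homogeneous_pr setup uL_in).
have := homogeneousM muV monomial (homogeneous_Reval setup f0 f_att).
rewrite addr0 addrC (uLE setup f0) [_ + _ *+ _](attained_value on_left) -(uLE setup f0) => rhs.
exact: (homogeneous_greq muV (homogeneous_Hmu _ f0) rhs (residual_eqmod setup f0 f_att)).
Qed.
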